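(* The zero locus in $OG(6,12)_-$ of a general global section of the spinor bundle $\mathcal{S}_+$ is isomorphic to the Grassmannian $G(3,6)$.
   Context: Over $\mathbb{C}$. Let $V=\mathbb{C}^{12}=E\oplus F$ carry a non-degenerate quadratic form, with $E,F$ maximal isotropic, $F\simeq E^\vee$. The half-spin representations of $Spin_{12}$ are $\Delta_+=\wedge^{even}E$, $\Delta_-=\wedge^{odd}E$. The variety of maximal isotropic subspaces of $V$ has two components $OG(6,12)_\pm$, embedded respectively in $\mathbb{P}(\Delta_\pm)$. On $OG(6,12)_-$, the spinor bundle $\mathcal{S}_+$ is the irreducible homogeneous bundle of rank $6$ with $H^0(\mathcal{S}_+)=\Delta_+$, namely $\mathcal{S}_+=\mathcal{U}\otimes\mathcal{O}(1)$, where $\mathcal{U}$ is the tautological rank $6$ bundle and $\mathcal{O}(1)$ the hyperplane bundle of the embedding in $\mathbb{P}(\Delta_-)$; its determinant is $\mathcal{O}(4)$. *)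

(* Defs.v *)
From HB Require Import structures.
From mathcomp Require Import all_boot all_order all_algebra.
From mathcomp Require Import mpoly.
From mathcomp Require Import reals.
From mathcomp Require Import complex.

Set Implicit Arguments.
Unset Strict Implicit.
Unset Printing Implicit Defensive.

Import GRing.Theory.

Local Open Scope ring_scope.

(** * Projective varieties

   A subset of the projective space P(C^I) is represented by its punctured
   affine cone, a set of nonzero vectors x : {ffun I -> C} stable under nonzero
   scalars.  Varieties carry their reduced structure. *)

Section Projective.

Variable C : fieldType.

Definition point (I : finType) := {ffun I -> C}.

Definition coord_ring (I : finType) := {mpoly C[#|I|]}.

Definition evalp (I : finType) (F : coord_ring I) (x : point I) : C :=
  F.@[fun i => x (enum_val i)].

Definition same_line (I : finType) (x y : point I) : Prop :=
  exists2 c : C, c != 0 & forall i, y i = c * x i.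

(* f is a choice of representatives of a morphism X -> Y: near each point of X,
   the line of f x is the line of (G j x)_j for homogeneous forms G j of a
   common degree. *)
Definition regular_map (I J : finType) (X : point I -> Prop)
    (Y : point J -> Prop) (f : point I -> point J) : Prop :=
  (forall x, X x -> Y (f x)) /\
  (forall x0, X x0 ->
     exists (d : nat) (G : J -> coord_ring I),
       [/\ forall j, G j \is d.-homog,
           [ffun j => evalp (G j) x0] != 0
         & forall x, X x -> [ffun j => evalp (G j) x] != 0 ->
             same_line [ffun j => evalp (G j) x] (f x)]).

Definition isomorphic_varieties (I J : finType) (X : point I -> Prop)
    (Y : point J -> Prop) : Prop :=
  exists (f : point I -> point J) (g : point J -> point I),
    [/\ regular_map X Y f, regular_map Y X g,
        forall x, X x -> same_line x (g (f x))
      & forall y, Y y -> same_line y (f (g y))].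

Definition generated_ideal (A : comNzRingType) (S : A -> Prop) (F : A) : Prop :=
  exists r : seq (A * A),
    (forall a, a \in r -> S a.2) /\ F = \sum_(a <- r) a.1 * a.2.

(* F is in the localization of the ideal J at the point x *)
Definition locally_in (I : finType) (J : coord_ring I -> Prop) (x : point I)
    (F : coord_ring I) : Prop :=
  exists2 G : coord_ring I, evalp G x != 0 & J (G * F).

(* The local ring at x of the affine cone of the projective scheme defined by J
   has no nilpotents.  The punctured cone being a G_m-bundle over that scheme,
   for x <> 0 this says that the scheme is reduced at the point [x]. *)
Definition reduced_at (I : finType) (J : coord_ring I -> Prop) (x : point I) :
    Prop :=
  forall (F : coord_ring I) (k : nat),
    locally_in J x (F ^+ k) -> locally_in J x F.

(* G(k, n) in its Pluecker embedding in P(\wedge^k C^n) *)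
Definition plucker (k n : nat) (W : 'M[C]_(k, n)) :
    point {J : {set 'I_n} | #|J| == k} :=
  [ffun J : {J : {set 'I_n} | #|J| == k} => \det (\matrix_(i < k, j < k)
     W i (enum_val (cast_ord (esym (eqP (valP J))) j)))].

Definition grassmannian (k n : nat)
    (p : point {J : {set 'I_n} | #|J| == k}) : Prop :=
  exists2 W : 'M[C]_(k, n), row_free W & p = plucker W.

End Projective.

(** * The spinor variety OG(6,12)_- and its spinor bundle *)

Section Spinor.

Variable C : fieldType.

(* V = E + F: the first six coordinates of v are those of its E-part in a basis
   e_i, the last six those of its F-part in the dual basis f_i. *)
Definition V := 'rV[C]_(6 + 6).

Definition quad (v : V) : C := \sum_i lsubmx v 0 i * rsubmx v 0 i.

(* psi J is the coefficient in \wedge E of e_J, the product of the e_j for j in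
   J in increasing order. *)
Definition spinor := point C {set 'I_6}.

(* Clifford action of V on \wedge E: e_i acts by exterior product and f_i by
   contraction, so that v . (v . psi) = quad v * psi.  Moving e_i to its place
   in e_J costs one sign for each j in J with j < i. *)
Definition clifford (v : V) (psi : spinor) : spinor :=
  [ffun J : {set 'I_6} => \sum_(i < 6) (-1) ^+ #|[set j in J | (j < i)%N]| *
     (if i \in J then lsubmx v 0 i * psi (J :\ i)
      else rsubmx v 0 i * psi (i |: J))].

Definition odd_spinor (psi : spinor) : Prop :=
  forall J : {set 'I_6}, ~~ odd #|J| -> psi J = 0.

Definition maximal_isotropic (U : {vspace V}) : Prop :=
  \dim U = 6%N /\ (forall u, u \in U -> quad u = 0).

(* psi is a nonzero vector of the line in Delta_- that represents U; there is
   one exactly when U belongs to OG(6,12)_-.  This line is the fibre of O(-1)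
   at U. *)
Definition represents (U : {vspace V}) (psi : spinor) : Prop :=
  [/\ psi != 0, odd_spinor psi & forall u, u \in U -> clifford u psi = 0].

(* OG(6,12)_- in P(Delta_-), a linear subspace of P(\wedge E) *)
Definition OG_minus (psi : spinor) : Prop :=
  exists2 U, maximal_isotropic U & represents U psi.

(* Global sections of U (x) O(1) = Hom(O(-1), U): a nonzero psi in the fibre
   O(-1)_U is sent to a vector s psi of U, and the coordinates of s are regular
   sections of O(1), that is, locally quotients of forms of degrees d + 1 and d.
   Only the values of s on OG_minus matter. *)
Definition spinor_bundle_section (s : spinor -> V) : Prop :=
  (forall U psi, maximal_isotropic U -> represents U psi -> s psi \in U) /\
  (forall psi0, OG_minus psi0 ->
     exists (d : nat) (q : coord_ring C {set 'I_6})
            (p : 'I_(6 + 6) -> coord_ring C {set 'I_6}),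
       [/\ q \is d.-homog, forall j, p j \is d.+1.-homog, evalp q psi0 != 0
         & forall psi, OG_minus psi ->
             evalp q psi *: s psi = \row_j evalp (p j) psi]).

Definition zero_locus (s : spinor -> V) (psi : spinor) : Prop :=
  OG_minus psi /\ s psi = 0.

(* Homogeneous ideal of the scheme-theoretic zero locus of s: the ideal of
   OG(6,12)_- together with all the forms that restrict on it to q * s_j for
   some form q and some coordinate s_j of s.  (U is a subbundle of the trivial
   bundle V, so the zero scheme is cut out by the coordinates of s in V.) *)
Definition zero_scheme_generator (s : spinor -> V)
    (F : coord_ring C {set 'I_6}) : Prop :=
  (forall psi, OG_minus psi -> evalp F psi = 0) \/
  (exists (d : nat) (q : coord_ring C {set 'I_6}) (j : 'I_(6 + 6)),
     [/\ q \is d.-homog, F \is d.+1.-homog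
       & forall psi, OG_minus psi -> evalp F psi = evalp q psi * s psi 0 j]).

Definition zero_scheme_ideal (s : spinor -> V) :
    coord_ring C {set 'I_6} -> Prop :=
  generated_ideal (zero_scheme_generator s).

Definition has_coordinates (n : nat) (b : 'I_n -> spinor -> V) (c : 'I_n -> C)
    (s : spinor -> V) : Prop :=
  forall psi, OG_minus psi -> s psi = \sum_i c i *: b i psi.

Definition section_basis (n : nat) (b : 'I_n -> spinor -> V) : Prop :=
  [/\ forall i, spinor_bundle_section (b i),
      forall s, spinor_bundle_section s -> exists c, has_coordinates b c s
    & forall c, has_coordinates b c (fun=> 0) -> forall i, c i = 0].

(* P holds on a nonempty Zariski open subset of the (finite dimensional) space
   of global sections: in some basis, it holds off a proper hypersurface. *)
Definition for_general_section (P : (spinor -> V) -> Prop) : Prop :=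
  exists (n : nat) (b : 'I_n -> spinor -> V) (h : {mpoly C[n]}),
    [/\ section_basis b, h != 0
      & forall s c, spinor_bundle_section s -> has_coordinates b c s ->
          h.@[c] != 0 -> P s].

End Spinor.

(* Main.v *)
Require Import Defs.
From HB Require Import structures.
From mathcomp Require Import all_boot all_order all_algebra.
From mathcomp Require Import mpoly.
From mathcomp Require Import reals.
From mathcomp Require Import complex.
From mathcomp Require Import ring.

Set Implicit Arguments.
Unset Strict Implicit.
Unset Printing Implicit Defensive.

Import Order.TTheory GRing.Theory Num.Theory.

Local Open Scope ring_scope.

(** A spinor phi in Delta_+ defines the section B phi of S_+ whose value at a pure
    spinor psi is the vector dual to w |-> <phi, w . psi>.

    All sections are of this form.  A section is linear along the lines of
    OG(6,12)_-, because regular functions on P^1 are constant.  Scaling e_i and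
    its dual f_i inversely moves a pure spinor along such a line, which joins its
    parts with and without e_i; hence a section is determined linearly by its
    values at the basis spinors e_J, and comparing neighbouring J leaves exactly
    one parameter for each even subset of the basis.

    The Spin group generated by the elements 1 + t x y, with x and y isotropic and
    orthogonal, brings a general phi to a + b e_0...e_5: Gaussian elimination
    leaves the terms 1, e_0123, e_0145, e_2345 and e_012345, that is, a 2x2x2
    tensor, which is diagonalized where its hyperdeterminant does not vanish.

    For phi = a + b e_0...e_5 the equation B phi psi = 0 says that the components
    of psi of degrees 1 and 5 vanish, and the pure spinors of degree 3 are the
    decomposable elements of /\^3 E, that is, the cone over G(3,6).  The zero scheme
    is reduced because the quadrics that cut out OG(6,12)_- express, up to powers
    of the coordinate psi_J, every form on it through the coordinates of the affine
    chart of G(3,6) around e_J, which are algebraically independent. *)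

(** * Clifford action and pure spinors *)

(** [OG_minus] is existential in U. It is replaced by the quadrics [pure], in which U reappears as
    the set of all vectors [B phi psi]. Exterior product and contraction by the i-th basis vectors
    both read the coefficient at the set with i toggled, hence [flip].

    The Spin group enters only through linear bijections of the spinors that preserve [OG_minus] and
    transform the vectors [B phi psi] linearly; [equivalent] records just this, so that points,
    sections and ideals can all be transported.

    Being general has to be expressed by a nonzero polynomial in the coordinates of the section. The
    elimination is therefore free of divisions and can be run on the spinor whose coefficients are
    variables; its nonvanishing is tested at the single spinor 1 + e_0123 + e_0145 + e_2345.

    For reducedness, any form that vanishes on [OG_minus] lies in the ideal by definition, which
    supplies the relations. The opposite bound, that few forms lie in the ideal, comes from
    evaluation at points of the zero locus. *)

Definition flip (J : {set 'I_6}) (i : 'I_6) : {set 'I_6} :=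
  if i \in J then J :\ i else i |: J.

Lemma mem_flip J i k : (k \in flip J i) = (k \in J) (+) (k == i).
Proof.
rewrite /flip; case: ifP => iJ; rewrite !inE; case: (eqVneq k i) => [->|_] /=;
  by rewrite ?iJ ?addbF.
Qed.

Lemma flipK i : involutive (flip^~ i).
Proof. by move=> J; apply/setP=> k; rewrite !mem_flip -addbA addbb addbF. Qed.

Lemma flipC J i k : flip (flip J i) k = flip (flip J k) i.
Proof. by apply/setP=> l; rewrite !mem_flip -!addbA [(l == i) (+) _]addbC. Qed.

Lemma flip_inj i : injective (flip^~ i).
Proof. exact: can_inj (flipK i). Qed.

Lemma odd_flip J i : odd #|flip J i| = ~~ odd #|J|.
Proof.
rewrite /flip; case: ifP => iJ; last by rewrite cardsU1 iJ.
by rewrite [in RHS](cardsD1 i J) iJ /= negbK.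
Qed.

Section Sign.
Variable A : pzRingType.

Definition sg (J : {set 'I_6}) (i : 'I_6) : A :=
  (-1) ^+ #|[set j in J | (j < i)%N]|.

Lemma sg_sq J i : sg J i * sg J i = 1.
Proof. by rewrite -expr2 sqrr_sign. Qed.

Lemma sg_flip J i k : sg (flip J i) k = if (i < k)%N then - sg J k else sg J k.
Proof.
have -> : sg (flip J i) k =
    (-1) ^+ #|if (i < k)%N then flip [set j in J | (j < k)%N] i
              else [set j in J | (j < k)%N]|.
  congr (_ ^+ #|pred_of_set _|); apply/setP=> l.
  case: ifP => lik; rewrite ?mem_flip !inE mem_flip;
    by case: (eqVneq l i) => [->|_]; rewrite ?lik ?andbT ?andbF ?addbF.
case: ifP => // _.
by rewrite -signr_odd odd_flip signrN signr_odd.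
Qed.

(** Toggling the smaller of the two indices changes the sign attached to the larger one, but not
    conversely: this is the anticommutation of two distinct generators. *)
Lemma sg_flip_anti J i k : i != k ->
  sg J i * sg (flip J i) k = - (sg J k * sg (flip J k) i).
Proof.
move=> ik; rewrite !sg_flip.
have Hc : sg J i * sg J k = sg J k * sg J i by rewrite /sg -!exprD addnC.
by case: (ltngtP i k) => [||/val_inj e]; rewrite ?mulrN ?opprK ?Hc //; move: ik; rewrite e eqxx.
Qed.

End Sign.

Section Clifford.
Variable C : numFieldType.
Implicit Types (psi phi chi : spinor C) (u v w x y : V C) (J K A B : {set 'I_6}).
Implicit Types (i j k : 'I_6) (b : bool) (c t : C).

(* The coordinates of the E-part of v (b = true) and of its F-part (b = false). *)
Definition vcoef v b i : C := if b then lsubmx v 0 i else rsubmx v 0 i.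

Arguments vcoef : simpl never.

Lemma vcoefD v w b i : vcoef (v + w) b i = vcoef v b i + vcoef w b i.
Proof. by case: b; rewrite /vcoef !mxE. Qed.

Lemma vcoefZ c v b i : vcoef (c *: v) b i = c * vcoef v b i.
Proof. by case: b; rewrite /vcoef !mxE. Qed.

Lemma vcoef0 b i : vcoef 0 b i = 0.
Proof. by case: b; rewrite /vcoef !mxE. Qed.

Lemma vcoef_sum (I : finType) (F : I -> V C) b i :
  vcoef (\sum_k F k) b i = \sum_k vcoef (F k) b i.
Proof. by case: b; rewrite /vcoef !mxE summxE; apply: eq_bigr => k _; rewrite mxE. Qed.

Lemma vcoef_inj v w : (forall b i, vcoef v b i = vcoef w b i) -> v = w.
Proof.
move=> e; rewrite -[v]hsubmxK -[w]hsubmxK; congr row_mx; apply/rowP=> i.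
  exact: (e true).
exact: (e false).
Qed.

Definition vec (f : bool -> 'I_6 -> C) : V C :=
  row_mx (\row_i f true i) (\row_i f false i).

Lemma vcoef_vec f b i : vcoef (vec f) b i = f b i.
Proof. by case: b; rewrite /vcoef /vec ?row_mxKl ?row_mxKr mxE. Qed.

Definition base b i : V C := vec (fun b' i' => ((b' == b) && (i' == i))%:R).

Definition scale c psi : spinor C := [ffun J => c * psi J].

Lemma scaleE c psi J : scale c psi J = c * psi J.
Proof. by rewrite ffunE. Qed.

Lemma spinorD psi chi J : (psi + chi) J = psi J + chi J.
Proof. by rewrite ffunE. Qed.

Lemma spinorN psi J : (- psi) J = - psi J.
Proof. by rewrite ffunE. Qed.

Lemma spinor0 J : (0 : spinor C) J = 0.
Proof. by rewrite ffunE. Qed.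

Lemma cliffordE v psi J : clifford v psi J =
  \sum_i sg C J i * (vcoef v (i \in J) i * psi (flip J i)).
Proof.
by rewrite ffunE; apply: eq_bigr => i _; rewrite /sg /vcoef /flip; case: ifP.
Qed.

Lemma cliffordDl v w psi : clifford (v + w) psi = clifford v psi + clifford w psi.
Proof.
apply/ffunP=> J; rewrite spinorD !cliffordE -big_split; apply: eq_bigr => i _ /=.
by rewrite vcoefD mulrDl mulrDr.
Qed.

Lemma cliffordDr v psi chi : clifford v (psi + chi) = clifford v psi + clifford v chi.
Proof.
apply/ffunP=> J; rewrite spinorD !cliffordE -big_split; apply: eq_bigr => i _ /=.
by rewrite spinorD !mulrDr.
Qed.

Lemma cliffordZl c v psi : clifford (c *: v) psi = scale c (clifford v psi).
Proof.
apply/ffunP=> J; rewrite scaleE !cliffordE mulr_sumr; apply: eq_bigr => i _ /=.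
by rewrite vcoefZ -mulrA mulrCA.
Qed.

Lemma cliffordZr c v psi : clifford v (scale c psi) = scale c (clifford v psi).
Proof.
apply/ffunP=> J; rewrite scaleE !cliffordE mulr_sumr; apply: eq_bigr => i _ /=.
by rewrite scaleE; ring.
Qed.

Lemma clifford0l psi : clifford 0 psi = 0.
Proof.
by apply/ffunP=> J; rewrite cliffordE spinor0 big1 // => i _; rewrite vcoef0 mul0r mulr0.
Qed.

Lemma clifford0r v : clifford v 0 = 0.
Proof.
by apply/ffunP=> J; rewrite cliffordE spinor0 big1 // => i _; rewrite spinor0 !mulr0.
Qed.

Lemma clifford_suml (I : finType) (F : I -> V C) psi :
  clifford (\sum_k F k) psi = \sum_k clifford (F k) psi.
Proof.
by apply: (big_morph (fun v => clifford v psi)) => [v w|]; rewrite ?cliffordDl ?clifford0l.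
Qed.

Definition bil v w : C :=
  \sum_i (vcoef v true i * vcoef w false i + vcoef v false i * vcoef w true i).

Lemma bilC v w : bil v w = bil w v.
Proof. by apply: eq_bigr => i _; rewrite addrC mulrC [X in _ + X]mulrC. Qed.

Lemma bilDl u v w : bil (u + v) w = bil u w + bil v w.
Proof.
rewrite /bil -big_split; apply: eq_bigr => i _ /=.
by rewrite !vcoefD; ring.
Qed.

Lemma bilZl c v w : bil (c *: v) w = c * bil v w.
Proof.
rewrite /bil mulr_sumr; apply: eq_bigr => i _ /=.
by rewrite !vcoefZ; ring.
Qed.

Lemma bilDr u v w : bil w (u + v) = bil w u + bil w v.
Proof. by rewrite bilC bilDl !(bilC w). Qed.

Lemma bilZr c v w : bil w (c *: v) = c * bil w v.
Proof. by rewrite bilC bilZl (bilC w). Qed.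

Lemma bil_base v b i : bil v (base b i) = vcoef v (~~ b) i.
Proof.
rewrite /bil (bigD1 i) //= big1 ?addr0 => [|k ki];
  rewrite !vcoef_vec ?eqxx ?(negPf ki) ?andbF ?mulr0 ?addr0 //.
by case: b; rewrite /= ?mulr1 ?mulr0 ?add0r ?addr0.
Qed.

Lemma bil_inj v w : (forall u, bil v u = bil w u) -> v = w.
Proof.
by move=> e; apply: vcoef_inj => b i; have := e (base (~~ b) i); rewrite !bil_base negbK.
Qed.

Lemma quadE v : bil v v = 2 * quad v.
Proof.
rewrite /bil /quad mulr_sumr; apply: eq_bigr => i _.
by rewrite /vcoef [X in _ + X]mulrC -mulr2n mulr_natl.
Qed.

Lemma vcoef_base b i b' k : vcoef (base b i) b' k = ((b' == b) && (k == i))%:R.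
Proof. exact: vcoef_vec. Qed.

(** In the double sum over the two toggled indices, the terms with distinct indices cancel in pairs
    by [sg_flip_anti]; those with equal indices give the bilinear form. *)
Lemma clifford_anticomm v w psi :
  clifford v (clifford w psi) + clifford w (clifford v psi) = scale (bil v w) psi.
Proof.
apply/ffunP=> J; rewrite spinorD scaleE.
pose F i k := sg C J i * sg C (flip J i) k *
  ((vcoef v (i \in J) i * vcoef w (k \in flip J i) k +
    vcoef w (i \in J) i * vcoef v (k \in flip J i) k) * psi (flip (flip J i) k)).
have -> : clifford v (clifford w psi) J + clifford w (clifford v psi) J =
    \sum_i \sum_k F i k.
  rewrite !cliffordE -big_split; apply: eq_bigr => i _ /=.
  rewrite !cliffordE !mulr_sumr -big_split; apply: eq_bigr => k _ /=.
  rewrite /F; set s := sg C J i; set s' := sg _ _ k; set p := psi _.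
  by rewrite mulrDl mulrDr; congr (_ + _); rewrite -!mulrA; congr (_ * _); rewrite mulrCA !mulrA.
have F_anti i k : i != k -> F i k = - F k i.
  move=> ik; rewrite /F sg_flip_anti // mulNr; congr (- (_ * (_ * _))); last by rewrite flipC.
  rewrite !mem_flip (negPf ik) [k == i]eq_sym (negPf ik) !addbF addrC.
  by rewrite mulrC [X in _ + X]mulrC.
have -> : \sum_i \sum_k F i k = \sum_i F i i + \sum_i \sum_(k | k != i) F i k.
  by rewrite -big_split; apply: eq_bigr => i _ /=; rewrite (bigD1 i).
have -> : \sum_i \sum_(k | k != i) F i k = 0.
  have self_opp (x : C) : x = - x -> x = 0.
    by move/eqP; rewrite eq_sym eqNr => /eqP.
  apply: self_opp; rewrite {1}(exchange_big_dep xpredT) //= -sumrN; apply: eq_bigr => i _.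
  rewrite -sumrN; apply: eq_big => k; first by rewrite eq_sym.
  by move=> ki; rewrite F_anti // eq_sym.
rewrite addr0 /bil mulr_suml; apply: eq_bigr => i _.
rewrite /F sg_flip ltnn sg_sq mul1r flipK mem_flip eqxx addbT.
by case: (i \in J) => /=; ring.
Qed.

Lemma clifford_sq v psi : clifford v (clifford v psi) = scale (quad v) psi.
Proof.
apply/ffunP=> J; have /ffunP/(_ J) := clifford_anticomm v v psi.
rewrite spinorD !scaleE quadE -mulr2n -[_ *+ 2]mulr_natl -mulrA.
by apply: mulfI; rewrite pnatr_eq0.
Qed.

(* The vector dual to the linear form w |-> <phi, w . psi>. *)
Definition B phi psi : V C := vec (fun b i =>
  \sum_(A : {set 'I_6} | (i \in A) == ~~ b) phi A * (sg C A i * psi (flip A i))).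

Lemma bilB phi psi w : bil (B phi psi) w = \sum_A phi A * clifford w psi A.
Proof.
rewrite /bil.
under eq_bigr => i _ do rewrite !vcoef_vec addrC !mulr_suml.
under [in RHS]eq_bigr => A _ do rewrite cliffordE mulr_sumr.
rewrite exchange_big; apply: eq_bigr => i _.
rewrite [RHS](bigID (fun A : {set _} => i \in A)) /=; congr (_ + _);
  apply: eq_big => [A|A /eqP /= ->]; rewrite ?eqb_id ?eqbF_neg //;
  rewrite -!mulrA; congr (_ * (_ * _)); exact: mulrC.
Qed.

Definition delta J : spinor C := [ffun K => (K == J)%:R].

Lemma deltaE J K : delta J K = (K == J)%:R.
Proof. by rewrite ffunE. Qed.

Lemma sum_delta (f : {set 'I_6} -> C) J : \sum_K delta J K * f K = f J.
Proof.
rewrite (bigD1 J) //= deltaE eqxx mul1r big1 ?addr0 // => K.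
by rewrite deltaE => /negPf ->; rewrite mul0r.
Qed.

Lemma bilB_delta A psi w : bil (B (delta A) psi) w = clifford w psi A.
Proof. by rewrite bilB sum_delta. Qed.

Lemma B_delta A psi b i : vcoef (B (delta A) psi) b i =
  if (i \in A) == ~~ b then sg C A i * psi (flip A i) else 0.
Proof.
rewrite vcoef_vec; case: ifP => [iA|niA].
  rewrite (bigD1 A) //= deltaE eqxx mul1r big1 ?addr0 // => K /andP[_].
  by rewrite deltaE => /negPf ->; rewrite mul0r.
rewrite big1 // => K; rewrite deltaE; case: (eqVneq K A) => [->|_ _]; first by rewrite niA.
by rewrite mul0r.
Qed.

Lemma B_sum phi psi : B phi psi = \sum_A phi A *: B (delta A) psi.
Proof.
apply: bil_inj => w; rewrite bilB.
rewrite (big_morph (fun v => bil v w) (fun u v => bilDl u v w) (id1 := 0)); last first.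
  by rewrite -(scale0r (0 : V C)) bilZl mul0r.
by apply: eq_bigr => A _; rewrite bilZl bilB_delta.
Qed.

(** By [bilB], [B phi psi] is orthogonal to every vector that kills psi. If these vectors form a
    maximal isotropic subspace, it must lie among them, and this is the condition. *)
Definition pure psi : Prop := forall phi, clifford (B phi psi) psi = 0.

Lemma pure_delta psi : (forall A, clifford (B (delta A) psi) psi = 0) -> pure psi.
Proof.
move=> H phi; rewrite B_sum clifford_suml big1 // => A _.
by rewrite cliffordZl H; apply/ffunP=> J; rewrite scaleE spinor0 mulr0.
Qed.

(* The quadrics that cut out the variety of pure spinors. *)
Lemma clifford_B_delta A psi K : clifford (B (delta A) psi) psi K =
  \sum_(i | (i \in A) != (i \in K))
    sg C K i * (sg C A i * psi (flip A i) * psi (flip K i)).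
Proof.
rewrite cliffordE [RHS]big_mkcond; apply: eq_bigr => i _; rewrite B_delta.
by case: (i \in A); case: (i \in K); rewrite //= mul0r mulr0.
Qed.

Lemma isotropic_of_kills v psi : psi != 0 -> clifford v psi = 0 -> quad v = 0.
Proof.
move=> psi0 vpsi; apply/eqP; apply: contraNT psi0 => q0; apply/eqP.
have := clifford_sq v psi; rewrite vpsi clifford0r => /ffunP e.
apply/ffunP => J; have := e J; rewrite spinor0 scaleE => /esym/eqP.
by rewrite mulf_eq0 (negPf q0) /= => /eqP.
Qed.

Lemma orthogonal_of_kills v w psi :
  psi != 0 -> clifford v psi = 0 -> clifford w psi = 0 -> bil v w = 0.
Proof.
move=> psi0 vp wp; apply/eqP; apply: contraNT psi0 => q0; apply/eqP.
have := clifford_anticomm v w psi; rewrite vp wp !clifford0r addr0 => /ffunP e.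
apply/ffunP => J; have := e J; rewrite spinor0 scaleE => /esym/eqP.
by rewrite mulf_eq0 (negPf q0) /= => /eqP.
Qed.

End Clifford.

(** * Maximal isotropic subspaces and pure spinors *)

Section MaximalIsotropic.
Variable C : numFieldType.
Implicit Types (psi phi chi : spinor C) (u v w x y : V C) (J K A : {set 'I_6}).
Implicit Types (i j k : 'I_6) (b : bool) (c t : C) (U : {vspace V C}).

Lemma bil_isotropic U u v :
  maximal_isotropic U -> u \in U -> v \in U -> bil u v = 0.
Proof.
move=> [_ isoU] uU vU; have := quadE (u + v).
rewrite isoU ?rpredD // mulr0 bilDl !bilDr !quadE !isoU // !mulr0 (bilC v u).
by rewrite add0r addr0 -mulr2n => /eqP; rewrite mulrn_eq0 => /eqP.
Qed.

(** A count of ranks: [M'] is [M] with its E- and F-halves exchanged, so [kermx M'^T] is the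
    orthogonal of U. It has rank 12 - 6 and contains the row space of [M], of rank 6. *)
Lemma maximal_isotropic_orth U w :
  maximal_isotropic U -> (forall u, u \in U -> bil w u = 0) -> w \in U.
Proof.
move=> maxU worth; have [dimU _] := maxU.
have [X XU freeX] : exists2 X : 'I_(\dim U) -> V C, forall l, X l \in U &
    forall f : 'I_(\dim U) -> C, \sum_l f l *: X l = 0 -> f =1 (fun=> 0).
  exists (tnth (vbasis U)) => [l|f e l]; first exact/vbasis_mem/mem_tnth.
  have /freeP := basis_free (vbasisP U); apply.
  by rewrite -[RHS]e; apply: eq_bigr => l' _; rewrite (tnth_nth 0).
pose swap v : V C := row_mx (rsubmx v) (lsubmx v).
pose M := \matrix_(i < \dim U) X i.
pose M' := \matrix_(i < \dim U) swap (X i).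
have bil_swap v (i : 'I_(\dim U)) : (v *m M'^T) 0 i = bil v (X i).
  rewrite mxE big_split_ord /= /bil -big_split; apply: eq_bigr => k _ /=.
  rewrite /vcoef !mxE /swap; case: split_ordP => k' /eqP; last by rewrite eq_lrshift.
  rewrite eq_lshift => /eqP <-; case: split_ordP => k'' /eqP; first by rewrite eq_rlshift.
  by rewrite eq_rshift => /eqP <-; rewrite !mxE.
have freeM : row_free M.
  apply: inj_row_free => v; rewrite mulmx_sum_row => e.
  apply/rowP => i; rewrite mxE.
  apply: (freeX (fun l => v 0 l) _ i).
  by rewrite -[RHS]e; apply: eq_bigr => j _; rewrite rowK.
have freeM' : row_free M'.
  apply: inj_row_free => v; rewrite mulmx_sum_row => e.
  apply/rowP => i; rewrite mxE.
  apply: (freeX (fun l => v 0 l) _ i).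
  apply: vcoef_inj => b k; rewrite vcoef_sum vcoef0.
  transitivity (vcoef (\sum_i0 v 0 i0 *: row i0 M') (~~ b) k); last by rewrite e vcoef0.
  rewrite vcoef_sum; apply: eq_bigr => j _; rewrite !vcoefZ rowK; congr (_ * _).
  by case: b; rewrite /vcoef /swap /= ?row_mxKl ?row_mxKr.
have MK : (M <= kermx M'^T)%MS.
  apply/sub_kermxP/matrixP => i j; rewrite [RHS]mxE.
  have -> : (M *m M'^T) i j = (row i M *m M'^T) 0 j by rewrite -row_mul [RHS]mxE.
  by rewrite bil_swap rowK; apply: (bil_isotropic maxU).
have KM : (kermx M'^T <= M)%MS.
  rewrite -(mxrank_leqif_sup MK) mxrank_ker mxrank_tr.
  by rewrite (eqP freeM) (eqP freeM') dimU.
have /submx_trans/(_ KM)/submxP[D ->] : (w <= kermx M'^T)%MS.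
  by apply/sub_kermxP/rowP => i; rewrite bil_swap worth // mxE.
rewrite mulmx_sum_row; apply: rpred_sum => i _.
by rewrite rpredZ // rowK.
Qed.

Lemma represents_B U phi psi :
  maximal_isotropic U -> represents U psi -> B phi psi \in U.
Proof.
move=> maxU [_ _ kU]; apply: (maximal_isotropic_orth maxU) => u uU.
by rewrite bilB kU // big1 // => A _; rewrite spinor0 mulr0.
Qed.

Lemma spinor_neq0 psi : psi != 0 -> exists J, psi J != 0.
Proof.
move=> psi0; apply/existsP; apply: contraNT psi0; rewrite negb_exists => /forallP psi0.
by apply/eqP/ffunP => J; rewrite spinor0; apply/eqP; have := psi0 J; rewrite negbK.
Qed.

(** Conversely, where psi J0 is nonzero, the six vectors [B (delta (flip J0 i)) psi] span the
    required subspace. They kill psi, hence are isotropic. They are independent: among them only the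
    i-th has a nonzero coordinate at ([i \in J0], i), namely psi J0 up to sign. *)
Lemma OG_minusP psi : OG_minus psi <-> [/\ psi != 0, odd_spinor psi & pure psi].
Proof.
split=> [[U maxU rU]|[psi0 psiodd psipure]].
  have [psi0 psiodd kU] := rU; split=> // phi.
  exact/kU/represents_B.
have [J0 psiJ0] := spinor_neq0 psi0.
pose X := [tuple B (delta C (flip J0 i)) psi | i < 6].
have XE i : X`_i = B (delta C (flip J0 i)) psi.
  by rewrite -tnth_nth tnth_mktuple.
have kX u : u \in <<X>>%VS -> clifford u psi = 0.
  move=> /coord_span ->; rewrite clifford_suml big1 // => i _.
  rewrite cliffordZl XE psipure; apply/ffunP => J.
  by rewrite scaleE spinor0 mulr0.
exists <<X>>%VS; last by split.
split; last by move=> u /kX; apply: isotropic_of_kills.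
suff /eqP -> : free X by rewrite size_tuple.
apply/freeP => k e i.
have /eqP : vcoef (\sum_i0 k i0 *: X`_i0) (i \in J0) i = 0 by rewrite e vcoef0.
rewrite vcoef_sum (bigD1 i) //= big1 => [|l li].
  rewrite addr0 vcoefZ XE B_delta mem_flip eqxx addbT eqxx mulf_eq0 flipK.
  rewrite mulf_eq0 (negPf psiJ0) orbF => /orP[/eqP //|].
  by rewrite /sg signr_eq0.
rewrite vcoefZ XE B_delta mem_flip [i == l]eq_sym (negPf li) addbF.
by case: (i \in J0); rewrite mulr0.
Qed.

End MaximalIsotropic.

(** * The Spin group elements 1 + t x y and their action on sections *)

Section Moves.
Variable C : numFieldType.
Implicit Types (psi phi chi : spinor C) (u v w x y : V C) (J K A : {set 'I_6}).
Implicit Types (i j k : 'I_6) (b : bool) (a c t : C).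

Lemma pure_coord psi A K : pure psi ->
  \sum_(i | (i \in A) != (i \in K))
    sg C K i * (sg C A i * psi (flip A i) * psi (flip K i)) = 0.
Proof. by move=> purepsi; rewrite -clifford_B_delta purepsi spinor0. Qed.

Lemma pure_coordP psi :
  (forall A K, \sum_(i | (i \in A) != (i \in K))
    sg C K i * (sg C A i * psi (flip A i) * psi (flip K i)) = 0) -> pure psi.
Proof.
move=> H; apply: pure_delta => A; apply/ffunP => K.
by rewrite clifford_B_delta H spinor0.
Qed.

Definition weight i a c psi : spinor C :=
  [ffun J : {set 'I_6} => (if i \in J then a else c) * psi J].

(* The defining quadrics are homogeneous for the grading by i \in J. *)
Lemma pure_weight i a c psi : pure psi -> pure (weight i a c psi).
Proof.
move=> purepsi; apply: pure_coordP => A K.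
pose wt (J : {set 'I_6}) := if i \in J then a else c.
transitivity (wt A * wt K * 0); last by rewrite mulr0.
rewrite -[X in _ = _ * X](pure_coord A K purepsi) mulr_sumr; apply: eq_bigr => j; rewrite !ffunE !mem_flip /wt.
case: (eqVneq i j) => [-> |_ _]; last by rewrite !addbF; case: (i \in A); case: (i \in K); ring.
by case: (j \in A); case: (j \in K) => //= _; ring.
Qed.

Lemma pure_basis J : pure (delta C J).
Proof.
apply: pure_coordP => A K; rewrite big1 // => i; rewrite !deltaE.
case: (eqVneq (flip A i) J) => [<-|_]; last by rewrite mulr0 mul0r mulr0.
case: (eqVneq (flip K i) (flip A i)) => [/flip_inj ->|_]; first by rewrite eqxx.
by rewrite !mulr0.
Qed.

Lemma delta_neq0 J : delta C J != 0.
Proof.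
by apply/eqP => /ffunP/(_ J); rewrite deltaE eqxx spinor0 => /eqP; rewrite oner_eq0.
Qed.

Lemma odd_clifford v psi J :
  (forall K, odd #|K| = ~~ odd #|J| -> psi K = 0) -> clifford v psi J = 0.
Proof.
move=> H; rewrite cliffordE big1 // => i _.
by rewrite H ?odd_flip // !mulr0.
Qed.

(** Exchanges e_i and f_i. Exterior product by e_i and contraction by f_i are transposes of each
    other in the basis e_J, so [clifford (sharp v)] is the transpose of [clifford v]. *)
Definition sharp v := vec (fun b i => vcoef v (~~ b) i).

Lemma vcoef_sharp v b i : vcoef (sharp v) b i = vcoef v (~~ b) i.
Proof. exact: vcoef_vec. Qed.

Lemma bil_sharp v w : bil (sharp v) (sharp w) = bil v w.
Proof. by apply: eq_bigr => i _; rewrite !vcoef_sharp addrC. Qed.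

Lemma sharpK v : sharp (sharp v) = v.
Proof. by apply: vcoef_inj => b i; rewrite !vcoef_sharp negbK. Qed.

Lemma clifford_transpose v phi chi :
  \sum_A phi A * clifford v chi A = \sum_A clifford (sharp v) phi A * chi A.
Proof.
under eq_bigr => A _ do rewrite cliffordE mulr_sumr.
under [RHS]eq_bigr => A _ do rewrite cliffordE mulr_suml.
rewrite exchange_big [RHS]exchange_big; apply: eq_bigr => i _ /=.
rewrite (reindex_inj (@flip_inj i)); apply: eq_bigr => A _ /=.
rewrite flipK mem_flip eqxx addbT sg_flip ltnn vcoef_sharp.
by ring.
Qed.

Definition mv t x y psi := psi + scale t (clifford x (clifford y psi)).

Lemma mvE t x y psi J : mv t x y psi J = psi J + t * clifford x (clifford y psi) J.
Proof. by rewrite spinorD scaleE. Qed.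

Lemma mv_transpose t x y phi chi :
  \sum_A phi A * mv t x y chi A = \sum_A mv t (sharp y) (sharp x) phi A * chi A.
Proof.
under eq_bigr => A _ do rewrite mvE mulrDr mulrCA.
under [RHS]eq_bigr => A _ do rewrite mvE mulrDl -mulrA.
by rewrite !big_split /= -!mulr_sumr !clifford_transpose.
Qed.

Section Isotropic.
Variables (x y : V C).
Hypotheses (xx : bil x x = 0) (yy : bil y y = 0) (xy : bil x y = 0).

Lemma clifford_sq0 v psi : bil v v = 0 -> clifford v (clifford v psi) = 0.
Proof.
rewrite quadE clifford_sq => /eqP; rewrite mulf_eq0 pnatr_eq0 /= => /eqP ->.
by apply/ffunP => J; rewrite scaleE spinor0 mul0r.
Qed.

Lemma clifford_swap v w psi J :
  clifford v (clifford w psi) J = bil v w * psi J - clifford w (clifford v psi) J.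
Proof. by rewrite -scaleE -clifford_anticomm spinorD addrK. Qed.

(** Since x y x y = - x x y y = 0, the inverse of 1 + t x y is 1 - t x y. *)
Lemma mvK t : cancel (mv t x y) (mv (- t) x y).
Proof.
move=> psi; have e : clifford x (clifford y (mv t x y psi)) = clifford x (clifford y psi).
  rewrite /mv !cliffordDr !cliffordZr; apply/ffunP => J; rewrite spinorD scaleE.
  suff -> : clifford x (clifford y (clifford x (clifford y psi))) J = 0 by rewrite mulr0 addr0.
  have -> : clifford y (clifford x (clifford y psi)) = - clifford x (clifford y (clifford y psi)).
    by apply/ffunP => K; rewrite spinorN clifford_swap bilC xy mul0r sub0r.
  rewrite (clifford_sq0 _ yy) clifford0r; have -> : - (0 : spinor C) = 0 by rewrite oppr0.
  by rewrite clifford0r spinor0.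
by apply/ffunP => J; rewrite mvE e mvE; ring.
Qed.

(** Conjugation by 1 + t x y on V: the commutator of x y with w is <y,w> x - <x,w> y, and its
    commutator with x y vanishes in turn, so that no term in t^2 occurs. *)
Definition rot t w := w + t *: (bil y w *: x - bil x w *: y).

Lemma bil_rot t v w : bil (rot t v) w = bil v (rot (- t) w).
Proof.
rewrite /rot bilDl bilDr !bilZl !bilZr -!scaleN1r !bilDl !bilDr !bilZl !bilZr.
by rewrite (bilC v x) (bilC v y); ring.
Qed.

Lemma rotK t v : rot (- t) (rot t v) = v.
Proof.
have e z : bil z x = 0 -> bil z y = 0 -> bil z (rot t v) = bil z v.
  move=> zx zy; rewrite /rot bilDr !bilZr -!scaleN1r !bilDr !bilZr zx zy.
  by ring.
rewrite {1}/rot !e // ?(bilC y x) //.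
by rewrite /rot scaleNr addrK.
Qed.

Lemma clifford_mv t w psi :
  clifford w (mv t x y psi) = mv t x y (clifford (rot (- t) w) psi).
Proof.
rewrite /mv /rot cliffordDr cliffordZr !cliffordDl !cliffordZl -!scaleN1r !cliffordDl !cliffordZl.
apply/ffunP => J.
rewrite !(spinorD, scaleE, cliffordDr, cliffordZr).
have sw p q chi K : clifford p (clifford q chi) K = bil p q * chi K - clifford q (clifford p chi) K.
  exact: clifford_swap.
(* The commutator of x y with w, applied to psi; [e2] and [e3] then remove the terms in t^2. *)
have e1 : clifford x (clifford y (clifford w psi)) J =
    bil y w * clifford x psi J - bil x w * clifford y psi J
     + clifford w (clifford x (clifford y psi)) J.
  have -> : clifford y (clifford w psi) = scale (bil y w) psi - clifford w (clifford y psi).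
    by apply/ffunP => K; rewrite spinorD spinorN scaleE sw.
  rewrite cliffordDr cliffordZr spinorD scaleE.
  have -> : clifford x (- clifford w (clifford y psi)) J = - clifford x (clifford w (clifford y psi)) J.
    have -> : - clifford w (clifford y psi) = scale (-1) (clifford w (clifford y psi)).
      by apply/ffunP => K; rewrite spinorN scaleE mulN1r.
    by rewrite cliffordZr scaleE mulN1r.
  by rewrite [clifford x (clifford w _) J]sw; ring.
have e2 : clifford x (clifford y (clifford x psi)) J = 0.
  have -> : clifford y (clifford x psi) = scale (-1) (clifford x (clifford y psi)).
    by apply/ffunP => K; rewrite scaleE sw bilC xy; ring.
  by rewrite cliffordZr clifford_sq0 // scaleE spinor0 mulr0.
have e3 : clifford x (clifford y (clifford y psi)) J = 0.
  by rewrite clifford_sq0 // clifford0r spinor0.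
by rewrite e1 e2 e3; ring.
Qed.

Lemma B_mv t phi psi :
  B phi (mv t x y psi) = rot t (B (mv t (sharp y) (sharp x) phi) psi).
Proof.
apply: bil_inj => w; rewrite bil_rot !bilB clifford_mv.
exact: mv_transpose.
Qed.

(** Write g for the move. [B phi (g psi)] is the rotation of [B phi' psi] for the transposed spinor
    phi', and its action on g psi is g applied to that of [B phi' psi] on psi. *)
Lemma pure_mv t psi : pure psi -> pure (mv t x y psi).
Proof.
move=> purepsi phi; rewrite B_mv clifford_mv rotK purepsi.
by apply/ffunP => J; rewrite mvE spinor0 !clifford0r spinor0 mulr0 addr0.
Qed.

Lemma mv_eq0 t psi : mv t x y psi = 0 -> psi = 0.
Proof.
move=> e; rewrite -(mvK t psi) e.
by apply/ffunP => J; rewrite mvE spinor0 !clifford0r spinor0 mulr0 addr0.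
Qed.

Lemma odd_mv t psi : odd_spinor psi -> odd_spinor (mv t x y psi).
Proof.
move=> oddpsi J evJ; rewrite mvE oddpsi // odd_clifford ?mulr0 ?addr0 // => K evK.
apply: odd_clifford => L; rewrite evK negbK => evL.
by rewrite oddpsi // evL.
Qed.

Lemma OG_mv t psi : OG_minus psi -> OG_minus (mv t x y psi).
Proof.
rewrite !OG_minusP => -[psi0 oddpsi purepsi]; split.
- by apply: contra_neq psi0 => /mv_eq0.
- exact: odd_mv.
- exact: pure_mv.
Qed.

End Isotropic.

Definition spinor_linear (g : spinor C -> spinor C) : Prop :=
  exists m : {set 'I_6} -> {set 'I_6} -> C,
    forall psi K, g psi K = \sum_J m K J * psi J.

Lemma spinor_linear_id : spinor_linear id.
Proof.
exists (fun K J => delta C K J) => psi K.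
by rewrite sum_delta.
Qed.

Lemma spinor_linear_comp g g' :
  spinor_linear g -> spinor_linear g' -> spinor_linear (g \o g').
Proof.
move=> [m gE] [m' gE']; exists (fun K J => \sum_L m K L * m' L J) => psi K.
rewrite /= gE; under [LHS]eq_bigr => L _ do rewrite gE' mulr_sumr.
rewrite exchange_big; apply: eq_bigr => J _ /=.
by rewrite mulr_suml; apply: eq_bigr => L _; rewrite mulrA.
Qed.

Lemma spinor_linear_clifford v : spinor_linear (clifford v).
Proof.
exists (fun K J => clifford v (delta C J) K) => psi K; rewrite cliffordE.
under [RHS]eq_bigr => J _ do rewrite cliffordE mulr_suml.
rewrite exchange_big; apply: eq_bigr => i _ /=.
rewrite -(sum_delta psi (flip K i)) !mulr_sumr; apply: eq_bigr => J _.
by rewrite !deltaE eq_sym; ring.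
Qed.

Lemma spinor_linear_mv t x y : spinor_linear (mv t x y).
Proof.
have [m idE] := spinor_linear_id.
have [m' gE] := spinor_linear_comp (spinor_linear_clifford x) (spinor_linear_clifford y).
exists (fun K J => m K J + t * m' K J) => psi K.
rewrite mvE -[clifford _ _ _]/((clifford x \o clifford y) psi K) gE {1}idE mulr_sumr.
by rewrite -big_split; apply: eq_bigr => J _ /=; ring.
Qed.

(* g intertwines, up to an isometry of V, the sections attached to phi and
   phi'; it suffices to know that each coordinate of B phi' (g psi) is a linear
   form in B phi psi. *)
Definition intertwines (g : spinor C -> spinor C) phi phi' : Prop :=
  [/\ spinor_linear g, forall psi, OG_minus psi -> OG_minus (g psi)
    & forall w, exists u, forall psi, bil (B phi' (g psi)) w = bil (B phi psi) u].

Definition equivalent phi phi' : Prop :=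
  exists g g', [/\ cancel g g', cancel g' g, intertwines g phi phi'
                 & intertwines g' phi' phi].

Lemma intertwines_comp g g' phi phi' phi'' :
  intertwines g phi phi' -> intertwines g' phi' phi'' ->
  intertwines (g' \o g) phi phi''.
Proof.
move=> [lg Og Bg] [lg' Og' Bg']; split; first exact: spinor_linear_comp.
  by move=> psi /Og /Og'.
move=> w; have [u Hu] := Bg' w; have [u' Hu'] := Bg u.
by exists u' => psi; rewrite Hu Hu'.
Qed.

Lemma equivalent_trans phi phi' phi'' :
  equivalent phi phi' -> equivalent phi' phi'' -> equivalent phi phi''.
Proof.
move=> [g1 [g1' [gK1 gK1' i1 i1']]] [g2 [g2' [gK2 gK2' i2 i2']]].
exists (g2 \o g1), (g1' \o g2'); split.
- exact: can_comp.
- exact: can_comp.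
- exact: intertwines_comp i1 i2.
- exact: intertwines_comp i2' i1'.
Qed.

Lemma equivalent_scale c phi : c != 0 -> equivalent phi (scale c phi).
Proof.
move=> c0; have Bscale a chi psi w : bil (B (scale a chi) psi) w = bil (B chi psi) (a *: w).
  rewrite bilZr !bilB mulr_sumr; apply: eq_bigr => A _.
  by rewrite scaleE mulrA.
exists id, id; split=> //; split=> // [|w]; try exact: spinor_linear_id.
  by exists (c *: w) => psi.
exists (c^-1 *: w) => psi; rewrite Bscale scalerA mulfV //.
by rewrite scale1r.
Qed.

(** The contragredient move acts on psi: transposition reverses the product and applies [sharp],
    inversion changes the sign of t. *)
Lemma equivalent_mv t x y phi :
  bil x x = 0 -> bil y y = 0 -> bil x y = 0 -> equivalent phi (mv t x y phi).
Proof.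
move=> xx yy xy.
have [xx' yy' yx'] : [/\ bil (sharp x) (sharp x) = 0, bil (sharp y) (sharp y) = 0
                       & bil (sharp y) (sharp x) = 0].
  by rewrite !bil_sharp (bilC y).
exists (mv (- t) (sharp y) (sharp x)), (mv t (sharp y) (sharp x)); split.
- by rewrite -{2}[t]opprK; apply: mvK.
- exact: mvK.
- split=> [|psi|w]; [exact: spinor_linear_mv|exact: OG_mv|].
  exists (rot (sharp y) (sharp x) t w) => psi.
  by rewrite B_mv // bil_rot opprK !sharpK mvK.
- split=> [|psi|w]; [exact: spinor_linear_mv|exact: OG_mv|].
  exists (rot (sharp y) (sharp x) (- t) w) => psi.
  by rewrite B_mv // bil_rot !sharpK.
Qed.

End Moves.

(** * Normal form of a general spinor *)

(* Subsets of 'I_6 are coded by bit strings, so that signs and vanishing patterns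
   can be computed. *)
Definition bits := seq bool.

Definition set_of_bits (s : bits) : {set 'I_6} := [set i : 'I_6 | nth false s i].

Definition flip_bits (s : bits) (i : nat) : bits := set_nth false s i (~~ nth false s i).

Lemma mem_set_of_bits s (i : 'I_6) : (i \in set_of_bits s) = nth false s i.
Proof. by rewrite inE. Qed.

Lemma flip_set_of_bits s (i : 'I_6) :
  flip (set_of_bits s) i = set_of_bits (flip_bits s i).
Proof.
apply/setP => k; rewrite mem_flip !mem_set_of_bits nth_set_nth /=.
rewrite -val_eqE /=; case: eqP => [->|_]; last by rewrite addbF.
by rewrite addbT.
Qed.

Fixpoint all_bits (n : nat) : seq bits :=
  if n is n'.+1 then map (cons false) (all_bits n') ++ map (cons true) (all_bits n')
  else [:: [::]].

Lemma mem_all_bits s : s \in all_bits (size s).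
Proof.
elim: s => //= b s IHs; rewrite mem_cat; apply/orP.
by case: b; [right|left]; apply: map_f.
Qed.

Lemma set_of_bits_surj (K : {set 'I_6}) :
  exists2 s, s \in all_bits 6 & K = set_of_bits s.
Proof.
exists (mkseq (fun k => inord k \in K) 6).
  by have := mem_all_bits (mkseq (fun k => inord k \in K) 6); rewrite size_mkseq.
by apply/setP => i; rewrite mem_set_of_bits nth_mkseq // inord_val.
Qed.

Lemma card_bits n (s : bits) :
  (size s <= n)%N -> #|[set j : 'I_n | nth false s j]| = count id s.
Proof.
elim: s n => [|b s IHs] n sn; first by apply: eq_card0 => j; rewrite inE nth_nil.
case: n sn => // n sn.
rewrite /= -(IHs n) // -!sum1dep_card big_mkcond big_ord_recl /=.
by rewrite [in RHS]big_mkcond; congr (_ + _)%N; case: b.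
Qed.

Lemma card_set_of_bits s (i : 'I_6) :
  #|[set j in set_of_bits s | (j < i)%N]| = count id (take i s).
Proof.
have -> : [set j in set_of_bits s | (j < i)%N] = [set j : 'I_6 | nth false (take i s) j].
  apply/setP => j; rewrite !inE; case: (ltnP j i) => [ji|ij].
    by rewrite andbT nth_take.
  by rewrite andbF nth_default // (leq_trans _ ij) // size_take_min geq_minl.
apply: card_bits; rewrite size_take_min (leq_trans (geq_minl _ _)) //.
exact: ltnW.
Qed.

(* (i, j, s) stands for x_i x_j, with x_i = e_i if i is in s and x_i = f_i
   otherwise; it sends the flip of s at i and j to s. *)
Definition shift := ('I_6 * 'I_6 * bits)%type.

Section Reduction.
Variable A : comNzRingType.
Implicit Types (phi : {ffun {set 'I_6} -> A}) (s : bits) (a c : A).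

Definition sg2 (K : {set 'I_6}) i j : A := sg A K i * sg A (flip K i) j.

Definition move a c (st : shift) phi : {ffun {set 'I_6} -> A} :=
  let: (i, j, s) := st in [ffun K : {set 'I_6} =>
    a * phi K + (if ((i \in K) == nth false s i) && ((j \in K) == nth false s j)
                 then c * (sg2 K i j * phi (flip (flip K i) j)) else 0)].

Definition pivot_index (st : shift) : {set 'I_6} :=
  let: (i, j, s) := st in flip (flip (set_of_bits s) i) j.

Definition target_index (st : shift) : {set 'I_6} := set_of_bits st.2.

(* Clears the coefficient at the target by means of the one at the pivot.  No
   division occurs, so that the reduction also applies to the generic spinor,
   with coefficients in a polynomial ring. *)
Definition kill (st : shift) phi : {ffun {set 'I_6} -> A} :=
  move (phi (pivot_index st))
       (- (sg2 (target_index st) st.1.1 st.1.2 * phi (target_index st))) st phi.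

Fixpoint run (l : seq shift) phi :=
  if l is st :: l' then run l' (kill st phi) else phi.

(** Each pivot is taken at the moment of its use. Where the product is nonzero, every [kill] of the
    run is invertible; as a function of phi the product is a polynomial. *)
Fixpoint pivots (l : seq shift) phi : A :=
  if l is st :: l' then phi (pivot_index st) * pivots l' (kill st phi) else 1.

Definition vanishes (Z : seq bits) phi := forall s, s \in Z -> phi (set_of_bits s) = 0.

Definition active (st : shift) s : bool :=
  let: (i, j, q) := st in
  (nth false s i == nth false q i) && (nth false s j == nth false q j).

Definition flip2 (st : shift) s : bits :=
  let: (i, j, _) := st in flip_bits (flip_bits s i) j.

(** Symbolic propagation of known zeros: a zero coefficient survives if it receives nothing or
    receives from another known zero. [kill_zeros] adds the target. The resulting vanishing patterns
    are found by computation, whatever the coefficients. *)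
Definition move_zeros (st : shift) (Z : seq bits) : seq bits :=
  [seq s <- all_bits 6 | (s \in Z) && (active st s ==> (flip2 st s \in Z))].

Definition kill_zeros (Z : seq bits) (st : shift) : seq bits :=
  [seq s <- all_bits 6 | (s == st.2) || (s \in Z) && (active st s ==> (flip2 st s \in Z))].

Definition sign_bits (s : bits) (i : nat) : bool := odd (count id (take i s)).

Definition sign2_bits (st : shift) s : bool :=
  let: (i, j, _) := st in sign_bits s i (+) sign_bits (flip_bits s i) j.

Lemma sg_bits s (i : 'I_6) : sg A (set_of_bits s) i = (-1) ^+ sign_bits s i.
Proof. by rewrite /sg card_set_of_bits signr_odd. Qed.

Lemma sg2_bits i j q s :
  sg2 (set_of_bits s) i j = (-1) ^+ sign2_bits (i, j, q) s.
Proof. by rewrite /sg2 flip_set_of_bits !sg_bits -signr_addb. Qed.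

Lemma move_bits a c st phi s : move a c st phi (set_of_bits s) =
  a * phi (set_of_bits s) + (if active st s
    then c * ((-1) ^+ sign2_bits st s * phi (set_of_bits (flip2 st s))) else 0).
Proof.
case: st => [[i j] q]; rewrite ffunE !mem_set_of_bits -(sg2_bits i j q).
by rewrite !flip_set_of_bits.
Qed.

Lemma kill_bits st phi s : kill st phi (set_of_bits s) =
  phi (set_of_bits (flip2 st st.2)) * phi (set_of_bits s) - (if active st s
    then (-1) ^+ (sign2_bits st st.2 (+) sign2_bits st s) * (phi (set_of_bits st.2) *
       phi (set_of_bits (flip2 st s))) else 0).
Proof.
rewrite /kill move_bits; case: st => [[i j] q] /=.
rewrite !flip_set_of_bits; congr (_ + _); case: ifP => _; last by rewrite oppr0.
rewrite (sg2_bits i j q) /target_index /= !signr_addb.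
move: ((-1 : A) ^+ sign_bits q i) ((-1 : A) ^+ sign_bits (flip_bits q i) j).
move: ((-1 : A) ^+ sign_bits s i) ((-1 : A) ^+ sign_bits (flip_bits s i) j).
by move=> *; ring.
Qed.

Lemma pivot_bits st : pivot_index st = set_of_bits (flip2 st st.2).
Proof. by case: st => [[i j] q]; rewrite /= !flip_set_of_bits. Qed.

Lemma vanishes_move a c st Z phi :
  vanishes Z phi -> vanishes (move_zeros st Z) (move a c st phi).
Proof.
move=> Zphi s; rewrite mem_filter => /andP[/andP[sZ act] _].
rewrite move_bits (Zphi s) // mulr0 add0r; case: ifP => // st_s.
by rewrite Zphi ?mulr0 //; move: act; rewrite st_s.
Qed.

Lemma vanishes_kill st Z phi :
  vanishes Z phi -> vanishes (kill_zeros Z st) (kill st phi).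
Proof.
move=> Zphi s; rewrite mem_filter => /andP[/orP[/eqP ->|/andP[sZ act]] s6].
  rewrite kill_bits addbb /= mul1r; case: ifP => [_|]; first by rewrite mulrC subrr.
  by case: st {Zphi s6} => [[i j] q] /=; rewrite !eqxx.
rewrite kill_bits (Zphi s) // mulr0 sub0r; case: ifP => // st_s; last by rewrite oppr0.
by rewrite (Zphi (flip2 _ _)) ?mulr0 ?oppr0 //; move: act; rewrite st_s.
Qed.

Lemma vanishes_run l Z phi :
  vanishes Z phi -> vanishes (foldl kill_zeros Z l) (run l phi).
Proof.
by elim: l Z phi => //= st l IHl Z phi Zphi; apply/IHl/vanishes_kill.
Qed.

(** Allows the genericity polynomial to be evaluated at one explicit spinor, which the whole
    reduction leaves unchanged. *)
Lemma run_fixed l phi :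
  (forall st, st \in l -> phi (pivot_index st) = 1 /\ phi (target_index st) = 0) ->
  run l phi = phi /\ pivots l phi = 1.
Proof.
elim: l => //= st l IHl H; have [p1 q0] := H st (mem_head _ _).
have -> : kill st phi = phi.
  apply/ffunP => K; rewrite /kill p1 q0 mulr0 oppr0; case: st {H p1 q0} => [[i j] q].
  by rewrite ffunE mul1r mul0r if_same addr0.
by rewrite p1 mul1r; apply: IHl => st' st'l; apply: H; rewrite inE st'l orbT.
Qed.

End Reduction.

Definition map_spinor (A A' : comNzRingType) (f : A -> A')
  (phi : {ffun {set 'I_6} -> A}) : {ffun {set 'I_6} -> A'} := [ffun K => f (phi K)].

Section Naturality.
Variables (A A' : comNzRingType) (f : {rmorphism A -> A'}).
Implicit Types (phi : {ffun {set 'I_6} -> A}).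

Lemma map_kill st phi : kill st (map_spinor f phi) = map_spinor f (kill st phi).
Proof.
have fsg K i : f (sg A K i) = sg A' K i by rewrite rmorphXn rmorphN1.
case: st => [[i j] q]; apply/ffunP => K; rewrite !ffunE rmorphD rmorphM /=.
congr (_ + _); case: ifP => _; last by rewrite rmorph0.
by rewrite !rmorphM rmorphN !rmorphM /= !fsg.
Qed.

Lemma map_run l phi : run l (map_spinor f phi) = map_spinor f (run l phi).
Proof. by elim: l phi => //= st l IHl phi; rewrite map_kill IHl. Qed.

Lemma map_pivots l phi : pivots l (map_spinor f phi) = f (pivots l phi).
Proof.
elim: l phi => [|st l IHl] phi /=; first by rewrite rmorph1.
by rewrite map_kill IHl rmorphM ffunE.
Qed.

End Naturality.

Section Orbits.
Variable C : numFieldType.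
Implicit Types (phi : spinor C).

Lemma clifford_base b i (psi : spinor C) K : clifford (base C b i) psi K =
  if (i \in K) == b then sg C K i * psi (flip K i) else 0.
Proof.
rewrite cliffordE (bigD1 i) //= big1 => [|k /negPf ki]; rewrite vcoef_base ?ki ?andbF ?mul0r ?mulr0 //.
by rewrite eqxx andbT addr0; case: ifP => _; rewrite ?mul1r ?mul0r ?mulr0.
Qed.

(** [move a c] is a times 1 + (c / a) x_i x_j, and basis vectors with distinct indices are isotropic
    and orthogonal. *)
Lemma equivalent_move (a c : C) (st : shift) phi :
  st.1.1 != st.1.2 -> a != 0 -> equivalent phi (move a c st phi).
Proof.
case: st => [[i j] q]; rewrite [_.1.1]/= [_.1.2]/= => ij a0.
have bil_base b i' b' j' : bil (base C b i') (base C b' j') = ((~~ b' == b) && (j' == i'))%:R.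
  by rewrite bil_base vcoef_base.
set x := base C (nth false q i) i; set y := base C (nth false q j) j.
have /equivalent_trans : equivalent phi (mv (c / a) x y phi).
  by apply: equivalent_mv; rewrite bil_base ?(eq_sym j) ?(negPf ij) ?andbF //; case: nth.
apply; suff -> : move a c (i, j, q) phi = scale a (mv (c / a) x y phi).
  exact: equivalent_scale.
apply/ffunP => K; rewrite scaleE mvE mulrDr ffunE; congr (_ + _).
rewrite [RHS]mulrA [a * _]mulrC divfK // clifford_base clifford_base mem_flip [j == i]eq_sym (negPf ij) addbF.
case: eqP => //= _; last by rewrite mulr0.
by case: eqP => _; rewrite ?mulr0 // /sg2 -!mulrA.
Qed.

Definition proper_shifts (l : seq shift) := all (fun st : shift => st.1.1 != st.1.2) l.

Lemma equivalent_run l phi :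
  proper_shifts l -> pivots l phi != 0 -> equivalent phi (run l phi).
Proof.
elim: l phi => [|st l IHl] phi /=.
  move=> _ _; have e : scale 1 phi = phi by apply/ffunP => K; rewrite scaleE mul1r.
  by have := equivalent_scale phi (oner_neq0 C); rewrite e.
move=> /andP[prop_st prop_l]; rewrite mulf_eq0 negb_or => /andP[p0 pl0].
by apply: equivalent_trans (IHl _ prop_l pl0); apply: equivalent_move.
Qed.

End Orbits.

Definition ords : seq 'I_6 :=
  [:: @Ordinal 6 0 isT; @Ordinal 6 1 isT; @Ordinal 6 2 isT;
      @Ordinal 6 3 isT; @Ordinal 6 4 isT; @Ordinal 6 5 isT].

Definition ord_at k : 'I_6 := nth (@Ordinal 6 0 isT) ords k.

Definition bits_of (l : seq nat) : bits := [seq k \in l | k <- iota 0 6].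

(** Described from the pivot: [s] is the pivot, and the target is [s] with i and j toggled. *)
Definition toggle (i j : nat) (s : bits) : shift :=
  (ord_at i, ord_at j, flip_bits (flip_bits s i) j).

(* The pivots are 1 (to clear degree 2), then e_0123 and e_0145 (to clear the
   remaining entries of the skew form dual to the degree 4 part). *)
Definition reduction : seq shift :=
  [seq toggle p.1 p.2 (bits_of [::])
     | p <- [seq (i, j) | i <- iota 0 6, j <- iota 0 6] & (p.1 < p.2)%N] ++
  [seq toggle i j (bits_of [:: 0; 1; 2; 3]) | i <- [:: 0; 1; 2; 3], j <- [:: 4; 5]]%N ++
  [seq toggle i j (bits_of [:: 0; 1; 4; 5]) | i <- [:: 0; 1], j <- [:: 2; 3]]%N.

Definition odd_bits : seq bits := [seq s <- all_bits 6 | odd (count id s)].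

Definition s_ := bits_of [::].
Definition s01 := bits_of [:: 0; 1]%N.
Definition s23 := bits_of [:: 2; 3]%N.
Definition s45 := bits_of [:: 4; 5]%N.
Definition s0123 := bits_of [:: 0; 1; 2; 3]%N.
Definition s0145 := bits_of [:: 0; 1; 4; 5]%N.
Definition s2345 := bits_of [:: 2; 3; 4; 5]%N.
Definition sT := bits_of [:: 0; 1; 2; 3; 4; 5]%N.

Definition reduced_zeros : seq bits := foldl kill_zeros odd_bits reduction.

Definition covers (Z l : seq bits) := all (fun s => (s \in Z) || (s \in l)) (all_bits 6).

Lemma reduction_proper : proper_shifts reduction.
Proof. by vm_compute. Qed.

Section Normalization.
Variable A : comNzRingType.
Implicit Types (phi : {ffun {set 'I_6} -> A}) (s : bits).

(* Besides the denominators of the diagonalization, this is the hyperdeterminant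
   of the 2x2x2 tensor that the reduction leaves. *)
Definition discriminant phi : A :=
  let p := phi (set_of_bits s_) in let x := phi (set_of_bits s0123) in
  let y := phi (set_of_bits s0145) in let z := phi (set_of_bits s2345) in
  let w := phi (set_of_bits sT) in
  p * y * z * ((p * w) ^+ 2 + p * x * y * z *+ 4).

Definition genericity phi : A :=
  pivots reduction phi * discriminant (run reduction phi).

Lemma kill_active st s P s' phi :
  [&& flip2 st st.2 == P, active st s, flip2 st s == s'
    & sign2_bits st st.2 == sign2_bits st s] ->
  kill st phi (set_of_bits s) = phi (set_of_bits P) * phi (set_of_bits s)
    - phi (set_of_bits st.2) * phi (set_of_bits s').
Proof.
case/and4P => /eqP <- act /eqP <- /eqP sgn.
by rewrite kill_bits act sgn addbb mul1r.
Qed.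

Lemma kill_inactive st s P phi :
  (flip2 st st.2 == P) && ~~ active st s ->
  kill st phi (set_of_bits s) = phi (set_of_bits P) * phi (set_of_bits s).
Proof. by case/andP => /eqP <- /negPf act; rewrite kill_bits act subr0. Qed.

Lemma move_inactive (a c : A) st s phi :
  ~~ active st s -> move a c st phi (set_of_bits s) = a * phi (set_of_bits s).
Proof. by move=> /negPf act; rewrite move_bits act addr0. Qed.

Lemma move_active (a c : A) st s s' phi :
  [&& active st s, flip2 st s == s' & sign2_bits st s] ->
  move a c st phi (set_of_bits s) = a * phi (set_of_bits s) - c * phi (set_of_bits s').
Proof.
by case/and3P => act /eqP <- sgn; rewrite move_bits act sgn mulN1r mulrN.
Qed.

End Normalization.

(** * Diagonalization of the remaining 2x2x2 tensor *)

Section Diagonalization.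
Variable C : numClosedFieldType.
Implicit Types (phi psi : spinor C).

Definition diagonal (a b : C) : spinor C :=
  [ffun K : {set 'I_6} => if K == set0 then a else if K == setT then b else 0].

(** Contraction by f_4 f_5 creates terms in e_01 and e_23 and changes the coefficient of e_0123.
    Once [st1] and [st2] have cleared the two new terms by the pivot 1, the coefficient of e_0123 is
    quadratic in the parameter and can be made zero. [st3] and [st4] clear e_2345 and e_0145 by the
    top term; this creates a term in e_45, which [st5] clears. *)
Definition st_special : shift := toggle 4 5 s45.
Definition st1 : shift := toggle 0 1 s_.
Definition st2 : shift := toggle 2 3 s_.
Definition st3 : shift := toggle 0 1 sT.
Definition st4 : shift := toggle 2 3 sT.
Definition st5 : shift := toggle 4 5 s_.

Lemma diagonalize phi :
  vanishes odd_bits phi -> genericity phi != 0 ->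
  exists a b, [/\ a != 0, b != 0 & equivalent phi (diagonal a b)].
Proof.
move=> oddphi; rewrite /genericity mulf_eq0 negb_or => /andP[piv0].
have := equivalent_run reduction_proper piv0.
have : vanishes reduced_zeros (run reduction phi) by apply: vanishes_run.
move: (run reduction phi) => psi Zpsi equiv_psi.
rewrite /discriminant; pose v (chi : spinor C) s := chi (set_of_bits s).
rewrite -!/(v psi _); set p := v psi s_; set x := v psi s0123.
set y := v psi s0145; set z := v psi s2345; set w := v psi sT.
rewrite !mulf_eq0 !negb_or => /andP[/andP[/andP[p0 y0] z0]].
set d := _ + _ => d0.
pose r := sqrtC d; have r2 : r ^+ 2 = d by rewrite sqrtCK.
have r0 : r != 0 by rewrite sqrtC_eq0.
(* A root of y z t^2 - p w t - p x, whose discriminant is [d]; this polynomial is, up to sign and a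
   power of p, what [st1] and [st2] leave at e_0123. *)
pose t := (p * w + r) / (2 * y * z).
have two0 : 2 != 0 :> C by rewrite pnatr_eq0.
have tr : 2 * y * z * t = p * w + r.
  by rewrite /t mulrC divfK // !mulf_neq0.
have t_root : y * z * t ^+ 2 = p * w * t + p * x.
  apply: (mulfI (mulf_neq0 two0 (mulf_neq0 two0 (mulf_neq0 y0 z0)))).
  transitivity ((2 * y * z * t) ^+ 2); first by ring.
  transitivity (2 * p * w * (2 * y * z * t) + 4 * p * x * y * z); last by ring.
  rewrite tr sqrrD r2 /d.
  by ring.
pose chi1 := move 1 (- t) st_special psi.
pose chi2 := kill st1 chi1; pose chi3 := kill st2 chi2.
pose Z1 := move_zeros st_special reduced_zeros.
have Zchi1 : vanishes Z1 chi1 by apply: vanishes_move.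
pose Z2 := kill_zeros Z1 st1; have Zchi2 : vanishes Z2 chi2 by apply: vanishes_kill.
pose Z3 := kill_zeros Z2 st2; have Zchi3 : vanishes Z3 chi3 by apply: vanishes_kill.
have a1 s s' : [&& active st_special s, flip2 st_special s == s' & sign2_bits st_special s] ->
    v chi1 s = v psi s + t * v psi s'.
  by move=> h; rewrite /v /chi1 (move_active _ _ _ h) mul1r mulNr opprK.
have i1 s : ~~ active st_special s -> v chi1 s = v psi s.
  by move=> h; rewrite /v /chi1 (move_inactive _ _ _ h) mul1r.
have Z0 s : s \in reduced_zeros -> v psi s = 0 by apply: Zpsi.
have psi01 : v psi s01 = 0 by apply: Z0; vm_compute.
have psi23 : v psi s23 = 0 by apply: Z0; vm_compute.
have psi45 : v psi s45 = 0 by apply: Z0; vm_compute.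
have chi1_ : v chi1 s_ = p by rewrite (a1 _ s45) // psi45 mulr0 addr0.
have chi1_01 : v chi1 s01 = t * y by rewrite (a1 _ s0145) // psi01 add0r.
have chi1_23 : v chi1 s23 = t * z by rewrite (a1 _ s2345) // psi23 add0r.
have chi1_0123 : v chi1 s0123 = x + t * w by rewrite (a1 _ sT).
have chi1_0145 : v chi1 s0145 = y by rewrite i1.
have chi1_2345 : v chi1 s2345 = z by rewrite i1.
have chi1_T : v chi1 sT = w by rewrite i1.
have chi1_45 : v chi1 s45 = 0 by rewrite i1.
have chi2_ : v chi2 s_ = p * p.
  by rewrite -{1 2}chi1_ /v /chi2 (@kill_inactive _ _ _ s_).
have chi2_01 : v chi2 s01 = 0 by apply: Zchi2; vm_compute.
have chi2_23 : v chi2 s23 = p * (t * z).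
  by rewrite -chi1_ -chi1_23 /v /chi2 (@kill_inactive _ _ _ s_).
have chi2_0123 : v chi2 s0123 = p * (x + t * w) - (t * y) * (t * z).
  by rewrite -chi1_ -chi1_0123 -chi1_01 -chi1_23 /v /chi2 (@kill_active _ _ _ s_ s23).
have chi2_0145 : v chi2 s0145 = p * y.
  rewrite -[RHS]subr0 -{1}chi1_ -chi1_0145 -(mulr0 (v chi1 s01)) -chi1_45.
  by rewrite /v /chi2 (@kill_active _ _ _ s_ s45).
have chi2_T : v chi2 sT = p * w - (t * y) * z.
  by rewrite -chi1_ -chi1_T -chi1_01 -chi1_2345 /v /chi2 (@kill_active _ _ _ s_ s2345).
have chi3_ : v chi3 s_ = (p * p) * (p * p).
  by rewrite -{1 2}chi2_ /v /chi3 (@kill_inactive _ _ _ s_).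
have chi3_0123 : v chi3 s0123 = 0.
  transitivity (v chi2 s_ * v chi2 s0123 - v chi2 s23 * v chi2 s01).
    by rewrite /v /chi3 (@kill_active _ _ _ s_ s01).
  rewrite chi2_01 mulr0 subr0 chi2_0123.
  have -> : p * (x + t * w) - t * y * (t * z) = p * w * t + p * x - y * z * t ^+ 2 by ring.
  by rewrite t_root subrr mulr0.
(* The top coefficient is p^2 (p w - 2 y z t) = - p^2 r, a multiple of the difference of the two
   roots; it survives because the discriminant does not vanish. *)
have chi3_T : v chi3 sT = - (p * p * r).
  transitivity (v chi2 s_ * v chi2 sT - v chi2 s23 * v chi2 s0145).
    by rewrite /v /chi3 (@kill_active _ _ _ s_ s0145).
  rewrite chi2_ chi2_T chi2_23 chi2_0145.
  transitivity (p * p * (p * w - 2 * y * z * t)); first by ring.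
  by rewrite tr; ring.
have p4 : v chi3 s_ != 0 by rewrite chi3_ !mulf_neq0.
have W0 : v chi3 sT != 0 by rewrite chi3_T oppr_eq0 !mulf_neq0.
pose chi4 := kill st3 chi3; pose chi5 := kill st4 chi4; pose chi6 := kill st5 chi5.
(* The zero at e_0123 comes from the choice of [t], so the symbolic propagation cannot detect it and
   it is added by hand. *)
pose Z3' := s0123 :: Z3.
have Zchi3' : vanishes Z3' chi3.
  by move=> s; rewrite inE => /orP[/eqP -> //|sZ3]; apply: Zchi3.
pose Z4 := kill_zeros Z3' st3; have Zchi4 : vanishes Z4 chi4 by apply: vanishes_kill.
pose Z5 := kill_zeros Z4 st4; have Zchi5 : vanishes Z5 chi5 by apply: vanishes_kill.
pose Z6 := kill_zeros Z5 st5; have Zchi6 : vanishes Z6 chi6 by apply: vanishes_kill.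
have chi4_T : v chi4 sT = v chi3 sT * v chi3 sT.
  by rewrite /v /chi4 (@kill_inactive _ _ _ sT).
have chi4_ : v chi4 s_ = v chi3 sT * v chi3 s_.
  rewrite -[RHS]subr0 -(mulr0 (v chi3 s2345)).
  have <- : v chi3 s01 = 0 by apply: Zchi3'; vm_compute.
  by rewrite /v /chi4 (@kill_active _ _ _ sT s01).
have chi5_T : v chi5 sT = v chi4 sT * v chi4 sT.
  by rewrite /v /chi5 (@kill_inactive _ _ _ sT).
have chi5_ : v chi5 s_ = v chi4 sT * v chi4 s_.
  rewrite -[RHS]subr0 -(mulr0 (v chi4 s0145)).
  have <- : v chi4 s23 = 0 by apply: Zchi4; vm_compute.
  by rewrite /v /chi5 (@kill_active _ _ _ sT s23).
have chi6_ : v chi6 s_ = v chi5 s_ * v chi5 s_.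
  by rewrite /v /chi6 (@kill_inactive _ _ _ s_).
have chi6_T : v chi6 sT = v chi5 s_ * v chi5 sT.
  rewrite -[RHS]subr0 -(mulr0 (v chi5 s45)).
  have <- : v chi5 s0123 = 0 by apply: Zchi5; vm_compute.
  by rewrite /v /chi6 (@kill_active _ _ _ s_ s0123).
have nz4T : v chi4 sT != 0 by rewrite chi4_T mulf_neq0.
have nz4_ : v chi4 s_ != 0 by rewrite chi4_ mulf_neq0.
have nz5T : v chi5 sT != 0 by rewrite chi5_T mulf_neq0.
have nz5_ : v chi5 s_ != 0 by rewrite chi5_ mulf_neq0.
exists (v chi6 s_), (v chi6 sT); split.
- by rewrite chi6_ mulf_neq0.
- by rewrite chi6_T mulf_neq0.
have set_s_ : set_of_bits s_ = set0.
  apply/setP => i; rewrite mem_set_of_bits inE; case: i => m ltm /=.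
  by do 6!(case: m ltm => [|m] ltm //=).
have set_sT : set_of_bits sT = setT.
  apply/setP => i; rewrite mem_set_of_bits inE; case: i => m ltm /=.
  by do 6!(case: m ltm => [|m] ltm //=).
suff -> : diagonal (v chi6 s_) (v chi6 sT) = chi6.
  have step st chi s : st.1.1 != st.1.2 -> flip2 st st.2 = s -> v chi s != 0 ->
      equivalent chi (kill st chi).
    by move=> prop_st e nz; apply: equivalent_move; rewrite // pivot_bits e.
  apply: equivalent_trans equiv_psi _.
  apply: (@equivalent_trans _ _ chi1); first by apply: equivalent_move; rewrite ?oner_neq0.
  apply: (@equivalent_trans _ _ chi2); first by apply: (step _ _ s_); rewrite ?chi1_.
  apply: (@equivalent_trans _ _ chi3).
    by apply: (step _ _ s_); rewrite ?chi2_ ?mulf_neq0.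
  apply: (@equivalent_trans _ _ chi4); first exact: (step _ _ sT).
  apply: (@equivalent_trans _ _ chi5); first exact: (step _ _ sT).
  exact: (step _ _ s_).
have Z6E : covers Z6 [:: s_; sT] by vm_compute.
clearbody Z6 chi6; apply/ffunP => K; rewrite ffunE -set_s_ -set_sT.
have [s s6 ->] := set_of_bits_surj K.
case: eqP => [->|ns_] //; case: eqP => [->|nsT] //.
have := allP Z6E s s6; rewrite !inE => /or3P[/Zchi6 -> //|/eqP e|/eqP e].
  by case: ns_; rewrite e.
by case: nsT; rewrite e.
Qed.

End Diagonalization.

(** * Global sections *)

Section PolynomialLemmas.
Variable C : numFieldType.

Lemma poly_eval0 (p : {poly C}) : (forall t, p.[t] = 0) -> p = 0.
Proof.
move=> p0; apply: (@roots_geq_poly_eq0 _ p [seq n%:R | n <- iota 0 (size p)]).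
- by apply/allP => x _; apply/rootP.
- by rewrite map_inj_uniq ?iota_uniq //; apply: mulrIn; rewrite oner_neq0.
- by rewrite size_map size_iota.
Qed.

(** Only a bound on the degree, so that c may be 0: along x + y t, a form of degree d has as
    coefficient of t^d its value at y, the point at infinity of the line. *)
Definition leads (d : nat) (p : {poly C}) (c : C) := (size p <= d.+1)%N /\ p`_d = c.

Lemma leads_mul d e p q a b : leads d p a -> leads e q b -> leads (d + e) (p * q) (a * b).
Proof.
move=> [sp <-] [sq <-]; split.
  apply: leq_trans (size_polyMleq p q) _.
  by apply: leq_trans (_ : (d.+1 + e.+1).-1 <= _)%N; [rewrite -!subn1 leq_sub2r // leq_add|rewrite addSn addnS].
rewrite coefM (bigD1 (Ordinal (leq_addr e d : (d < (d + e).+1)%N))) //= addKn.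
rewrite big1 ?addr0 // => i; rewrite -val_eqE /= => id.
case: (ltnP d i) => [di|le_id]; first by rewrite nth_default ?mul0r // (leq_trans sp).
rewrite [q`__]nth_default ?mulr0 // (leq_trans sq) //.
have lt_id : (i < d)%N by rewrite ltn_neqAle id le_id.
by rewrite ltn_subRL ltn_add2r.
Qed.

Lemma leads_exp d p a k : leads d p a -> leads (d * k) (p ^+ k) (a ^+ k).
Proof.
move=> pa; elim: k => [|k IHk].
  by rewrite muln0 !expr0; split; rewrite ?size_poly1 // coef1.
by rewrite mulnS !exprS; apply: leads_mul.
Qed.

Lemma leads_prod (I : Type) (r : seq I) (d : I -> nat) (p : I -> {poly C}) (a : I -> C) :
  (forall i, leads (d i) (p i) (a i)) ->
  leads (\sum_(i <- r) d i) (\prod_(i <- r) p i) (\prod_(i <- r) a i).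
Proof.
move=> pa; elim: r => [|i r IHr]; last by rewrite !big_cons; apply: leads_mul.
by rewrite !big_nil; split; rewrite ?size_poly1 // coef1.
Qed.

Variables (I : finType) (x y : point C I).

Definition restrict_line (F : coord_ring C I) : {poly C} :=
  \sum_(m <- msupp F) F@_m *:
     \prod_i ((x (enum_val i))%:P + (y (enum_val i))%:P * 'X) ^+ m i.

Lemma horner_restrict_line F t :
  (restrict_line F).[t] = evalp F [ffun j => x j + y j * t].
Proof.
rewrite /evalp mevalE horner_sum; apply: eq_bigr => m _.
rewrite hornerZ horner_prod; congr (_ * _); apply: eq_bigr => i _.
by rewrite !hornerE ffunE.
Qed.

Lemma leads_restrict_line d F : F \is d.-homog -> leads d (restrict_line F) (evalp F y).
Proof.
move=> homF; have lin i : leads 1 ((x i)%:P + (y i)%:P * 'X) (y i).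
  split; last by rewrite coefD coefC coefMX coefC /= add0r.
  by rewrite addrC size_MXaddC; case: ifP => // _; rewrite ltnS size_polyC leq_b1.
have homE m : m \in msupp F -> leads d (F@_m *: \prod_i
    ((x (enum_val i))%:P + (y (enum_val i))%:P * 'X) ^+ m i)
    (F@_m * \prod_i y (enum_val i) ^+ m i).
  move=> mF; have <- : mdeg m = d by have /dhomogP/(_ m mF) := homF.
  rewrite mdegE; have [sp cp] : leads (\sum_i m i) (\prod_i
      ((x (enum_val i))%:P + (y (enum_val i))%:P * 'X) ^+ m i)
      (\prod_i y (enum_val i) ^+ m i).
    by apply: leads_prod => i; rewrite -{1}[m i]mul1n; apply: leads_exp.
  by split; [rewrite (leq_trans (size_scale_leq _ _))|rewrite coefZ cp].
rewrite /restrict_line /evalp mevalE !big_seq.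
elim/big_ind2: _ => [|p a q b [sp <-] [sq <-]|m /homE //].
  by split; rewrite ?size_poly0 ?coef0.
split; last exact: coefD.
by rewrite (leq_trans (size_polyD _ _)) // geq_max sp sq.
Qed.

End PolynomialLemmas.

(** * Regular functions and sections of O(1) on a line *)

Section Lines.
Variable C : numClosedFieldType.
Implicit Types (f : C -> C) (P Q : {poly C}).

(* A function that is locally a quotient of polynomials is a polynomial: a
   denominator of least degree has no root. *)
Lemma regular_polynomial f Q1 P1 : Q1 != 0 ->
  (forall t, Q1.[t] * f t = P1.[t]) ->
  (forall t0, exists Q P, Q.[t0] != 0 /\ forall t, Q.[t] * f t = P.[t]) ->
  exists L, forall t, f t = L.[t].
Proof.
move=> Q1nz Q1f loc; elim: (size Q1) {-2}Q1 (leqnn (size Q1)) Q1nz P1 Q1f => {Q1}[|n IHn] Q1 sQ1 Q1nz P1 Q1f.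
  by move: Q1nz; rewrite -size_poly_gt0 ltnNge sQ1.
have [sQ1_1|/closed_rootP[t0 rt0]] := boolP (size Q1 == 1).
  have [c c0 Q1E] := size_poly1P _ sQ1_1.
  exists (c^-1 *: P1) => t; rewrite hornerZ -Q1f Q1E hornerC mulrA mulVf ?mul1r //.
have [Q [P [Qt0 Qf]]] := loc t0.
have cross : Q1 * P = P1 * Q.
  apply/eqP; rewrite -subr_eq0; apply/eqP/poly_eval0 => t.
  by rewrite !hornerE -Qf -Q1f; ring.
have /rootP P1t0 : root P1 t0.
  apply/rootP/(mulIf Qt0); rewrite mul0r -hornerM -cross hornerM.
  by rewrite (rootP rt0) mul0r.
have /factor_theorem[Q2 Q1E] := rt0.
have /factor_theorem[P2 P1E] : root P1 t0 by apply/rootP.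
have cross2 : Q2 * P = P2 * Q.
  apply: (mulIf (_ : 'X - t0%:P != 0)); first by rewrite polyXsubC_eq0.
  rewrite mulrAC -Q1E cross P1E; ring.
have Q2nz : Q2 != 0 by apply: contraNneq Q1nz => e; rewrite Q1E e mul0r.
apply: (IHn Q2 _ Q2nz P2) => [|t].
  move: sQ1; rewrite Q1E size_Mmonic ?monicXsubC // size_XsubC addn2 /=; exact.
(* At t0 itself the factor X - t0 cannot be cancelled; the equation there comes from the local
   quotient P / Q. *)
case: (eqVneq t t0) => [->|tt0].
  apply: (mulIf Qt0); rewrite -[RHS]hornerM -cross2 hornerM -Qf.
  by ring.
apply: (mulIf (_ : t - t0 != 0)); first by rewrite subr_eq0.
have := Q1f t; rewrite Q1E P1E !hornerM !hornerXsubC => <-.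
by ring.
Qed.

(** The denominator has degree exactly d because its value q at infinity is nonzero. The polynomial
    f thus has degree at most 1, and comparison of top coefficients gives its slope. *)
Lemma regular_affine f d Q1 P1 (q finf : C) : q != 0 -> leads d Q1 q -> leads d.+1 P1 (q * finf) ->
  (forall t, Q1.[t] * f t = P1.[t]) ->
  (forall t0, exists Q P, Q.[t0] != 0 /\ forall t, Q.[t] * f t = P.[t]) ->
  forall t, f t = f 0 + finf * t.
Proof.
move=> q0 [sQ Qd] [sP Pd] Q1f loc.
have Q1nz : Q1 != 0 by apply: contraNneq q0 => e; rewrite -Qd e coef0.
have [L fL] := regular_polynomial Q1nz Q1f loc.
have Q1L : Q1 * L = P1.
  apply/eqP; rewrite -subr_eq0; apply/eqP/poly_eval0 => t.
  by rewrite !hornerE -Q1f fL; ring.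
have sQ1 : size Q1 = d.+1.
  apply/eqP; rewrite eqn_leq sQ ltnNge; apply: contra q0 => sQd.
  by rewrite -Qd nth_default.
have sL : (size L <= 2)%N.
  case: (eqVneq L 0) => [->|L0]; first by rewrite size_poly0.
  by move: sP; rewrite -Q1L size_mul // sQ1 addSn /= -[d.+2]addn2 leq_add2l.
have LE : L = (L`_0)%:P + L`_1 *: 'X.
  apply/polyP => -[|[|n]]; rewrite coefD coefC coefZ coefX /= ?mulr0 ?mulr1 ?addr0 ?add0r //.
  by rewrite nth_default ?(leq_trans sL).
have L1 : L`_1 = finf.
  apply: (mulfI q0); rewrite -Pd -Q1L -Qd.
  have hQ : leads d Q1 Q1`_d by split; rewrite ?sQ1.
  have hL : leads 1 L L`_1 by [].
  by have [_] := leads_mul hQ hL; rewrite addn1 => ->.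
by move=> t; rewrite !fL LE !hornerE L1.
Qed.

End Lines.

(** * Determination of a section by its values at the basis spinors *)

Section Sections.
Variable C : numClosedFieldType.
Implicit Types (psi phi chi : spinor C) (J K A : {set 'I_6}) (i j k : 'I_6).

Lemma evalp_scale (I : finType) d (F : coord_ring C I) (x : point C I) c :
  F \is d.-homog -> evalp F [ffun j => c * x j] = c ^+ d * evalp F x.
Proof.
move=> /dhomogP homF; rewrite /evalp !mevalE mulr_sumr !big_seq; apply: eq_bigr => m mF.
rewrite mulrCA; congr (_ * _); rewrite -(homF m mF) /= mdegE.
rewrite -prodrXr -big_split; apply: eq_bigr => i _.
by rewrite ffunE exprMn.
Qed.

Variable s : spinor C -> V C.
Hypothesis s_sect : spinor_bundle_section s.

Lemma section_scale c psi : c != 0 -> OG_minus psi -> OG_minus (scale c psi) ->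
  s (scale c psi) = c *: s psi.
Proof.
move=> c0 OGpsi OGc; have [_ /(_ psi OGpsi)[d [q [p [hq hp q0 qs]]]]] := s_sect.
have qc : evalp q (scale c psi) = c ^+ d * evalp q psi by apply: evalp_scale.
apply/rowP => j; apply: (mulfI (mulf_neq0 (expf_neq0 d c0) q0)).
have /rowP/(_ j) := qs _ OGc; rewrite qc !mxE => ->.
rewrite (evalp_scale psi c (hp j)) mulrCA -mulrA -[evalp q psi * _]/((evalp q psi) * (s psi 0 j)).
have /rowP/(_ j) := qs _ OGpsi; rewrite !mxE => ->.
by rewrite exprS mulrA.
Qed.

(** The parametrization psi1 + t psi2 misses only the point psi2 of the line. The local expression
    of s at psi2 bounds the degree in t and makes s psi2 the slope; the identity is the value at t =
    1. *)
Lemma section_line psi1 psi2 :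
  (forall a b : C, (a != 0) || (b != 0) -> OG_minus [ffun J => a * psi1 J + b * psi2 J]) ->
  s (psi1 + psi2) = s psi1 + s psi2.
Proof.
move=> OGline; pose pt t : spinor C := [ffun J => psi1 J + psi2 J * t].
have OGpt t : OG_minus (pt t).
  suff -> : pt t = [ffun J => 1 * psi1 J + t * psi2 J] by apply: OGline; rewrite oner_neq0.
  by apply/ffunP => J; rewrite !ffunE mul1r mulrC.
have OG2 : OG_minus psi2.
  suff -> : psi2 = [ffun J => 0 * psi1 J + 1 * psi2 J] by apply: OGline; rewrite oner_neq0 orbT.
  by apply/ffunP => J; rewrite !ffunE mul1r mul0r add0r.
have [_ loc] := s_sect.
have restr q (p : 'I_(6 + 6) -> coord_ring C {set 'I_6}) (j : 'I_(6 + 6)) :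
    (forall psi, OG_minus psi -> evalp q psi *: s psi = \row_l evalp (p l) psi) ->
    forall t, (restrict_line psi1 psi2 q).[t] * s (pt t) 0 j =
              (restrict_line psi1 psi2 (p j)).[t].
  move=> qs t; have /rowP/(_ j) := qs _ (OGpt t); rewrite !mxE => e.
  by rewrite !horner_restrict_line.
apply/rowP => j; have [d [q [p [hq hp q0 qs]]]] := loc _ OG2.
have leadP : leads d.+1 (restrict_line psi1 psi2 (p j)) (evalp q psi2 * s psi2 0 j).
  have /rowP/(_ j) := qs _ OG2; rewrite !mxE => ->.
  exact: leads_restrict_line.
have loc_line t0 : exists Q P : {poly C},
    Q.[t0] != 0 /\ forall t, Q.[t] * s (pt t) 0 j = P.[t].
  have [d' [q' [p' [_ _ q'0 qs']]]] := loc _ (OGpt t0).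
  exists (restrict_line psi1 psi2 q'), (restrict_line psi1 psi2 (p' j)); split.
    by rewrite horner_restrict_line.
  exact: restr.
have := regular_affine q0 (leads_restrict_line psi1 psi2 hq) leadP (restr q p j qs) loc_line 1.
have -> : pt 1 = psi1 + psi2 by apply/ffunP => J; rewrite !ffunE mulr1.
have -> : pt 0 = psi1 by apply/ffunP => J; rewrite !ffunE mulr0 addr0.
by rewrite mulr1 => ->; rewrite [RHS]mxE.
Qed.

Lemma OG_weight i a b psi : OG_minus psi ->
  weight i a b psi != 0 -> OG_minus (weight i a b psi).
Proof.
rewrite !OG_minusP => -[_ oddpsi purepsi] nz; split=> //; last exact: pure_weight.
by move=> J evJ; rewrite ffunE oddpsi // mulr0.
Qed.

Lemma OG_delta J : odd #|J| -> OG_minus (delta C J).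
Proof.
move=> oddJ; apply/OG_minusP; split; [exact: delta_neq0| |exact: pure_basis].
by move=> K; rewrite deltaE; case: eqVneq => // ->; rewrite oddJ.
Qed.

Definition support psi : {set {set 'I_6}} := [set J | psi J != 0].

Lemma supportE psi J : (J \in support psi) = (psi J != 0).
Proof. by rewrite inE. Qed.

(** Induction on the size of the support: two of its members differ at some i, and the parts of psi
    with and without e_i have strictly smaller supports. A support with one member is settled by
    homogeneity. *)
Lemma section_linear psi : OG_minus psi -> s psi = \sum_J psi J *: s (delta C J).
Proof.
have [n] := ubnP #|support psi|; elim: n psi => // n IHn psi; rewrite ltnS => le_n OGpsi.
have /OG_minusP[psi0 oddpsi _] := OGpsi.
have [J psiJ] := spinor_neq0 psi0.
have [/forallP single|] := boolP [forall K, (psi K != 0) ==> (K == J)].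
  have oddJ : odd #|J| by apply: contraNT psiJ => /oddpsi ->.
  have psiK K : K != J -> psi K = 0.
    by move=> KJ; apply/eqP; have := single K; rewrite (negPf KJ) implybF negbK.
  have psiE : psi = scale (psi J) (delta C J).
    apply/ffunP => K; rewrite scaleE deltaE; case: (eqVneq K J) => [->|/psiK ->]; rewrite ?mulr1 ?mulr0 //.
  rewrite (bigD1 J) //= big1 => [|K /psiK ->]; last by rewrite scale0r.
  by rewrite addr0 {1}psiE section_scale -?psiE //; apply: OG_delta.
rewrite negb_forall => /existsP[K]; rewrite negb_imply => /andP[psiK KJ].
have [i Ki] : exists i, (i \in K) != (i \in J).
  apply/existsP; apply: contraNT KJ; rewrite negb_exists => /forallP e.
  by apply/eqP/setP => i; apply/eqP; have := e i; rewrite negbK.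
pose psi1 := weight i 1 0 psi; pose psi2 := weight i 0 1 psi.
have psi12 : psi = psi1 + psi2.
  apply/ffunP => L; rewrite !ffunE; case: ifP => _; rewrite !mul1r !mul0r ?addr0 ?add0r //.
have nz a b : (a != 0) || (b != 0) -> weight i a b psi != 0.
  move=> ab; apply/eqP => /ffunP e; have := e K; have := e J; rewrite !ffunE.
  move: Ki; case: (i \in K); case: (i \in J) => // _ /eqP; rewrite mulf_eq0 ?(negPf psiJ) ?(negPf psiK) orbF => /eqP b0 /eqP;
    by rewrite mulf_eq0 ?(negPf psiJ) ?(negPf psiK) orbF => /eqP a0; move: ab; rewrite a0 b0 eqxx.
have OG12 a b : (a != 0) || (b != 0) -> OG_minus (weight i a b psi).
  by move=> ab; apply: OG_weight => //; apply: nz.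
have OG1 : OG_minus psi1 by apply: OG12; rewrite oner_neq0.
have OG2 : OG_minus psi2 by apply: OG12; rewrite oner_neq0 orbT.
have small a b L : psi L != 0 -> weight i a b psi L = 0 ->
    (#|support (weight i a b psi)| < n)%N.
  move=> psiL wL; apply: leq_trans le_n; apply: proper_card.
  rewrite properE; apply/andP; split.
    apply/subsetP => M; rewrite !supportE ffunE; apply: contra => /eqP ->.
    by rewrite mulr0.
  by apply/subsetPn; exists L; rewrite !supportE // wL eqxx.
have small1 : (#|support psi1| < n)%N.
  case iJ: (i \in J).
    by apply: (small _ _ K) => //; rewrite ffunE; move: Ki; rewrite iJ; case: (i \in K) => //; rewrite mul0r.
  by apply: (small _ _ J) => //; rewrite ffunE iJ mul0r.
have small2 : (#|support psi2| < n)%N.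
  case iJ: (i \in J).
    by apply: (small _ _ J) => //; rewrite ffunE iJ mul0r.
  by apply: (small _ _ K) => //; rewrite ffunE; move: Ki; rewrite iJ; case: (i \in K) => //; rewrite mul0r.
rewrite {1}psi12 section_line => [|a b ab].
  rewrite !IHn // -big_split; apply: eq_bigr => L _ /=.
  by rewrite -scalerDl -spinorD -psi12.
suff -> : [ffun J => a * psi1 J + b * psi2 J] = weight i a b psi by apply: OG12.
apply/ffunP => L; rewrite !ffunE; case: ifP => _;
  by rewrite !mul0r mul1r !mulr0 ?addr0 ?add0r.
Qed.

Lemma section_kills psi : OG_minus psi -> clifford (s psi) psi = 0.
Proof.
move=> [U maxU rU]; have [sU _] := s_sect.
by have [_ _] := rU; apply; apply: sU.
Qed.

Lemma clifford_delta (v : V C) J i :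
  clifford v (delta C J) (flip J i) = sg C J i * vcoef v (i \notin J) i.
Proof.
rewrite cliffordE (bigD1 i) //= big1 => [|k /negPf ki].
  by rewrite mem_flip eqxx addbT flipK deltaE eqxx mulr1 addr0 sg_flip ltnn.
rewrite deltaE flipC; case: eqP => [/setP/(_ k)|]; last by rewrite !mulr0.
by rewrite !mem_flip ki eqxx addbF; case: (k \in J).
Qed.

Lemma clifford_base_delta J i :
  clifford (base C (i \notin J) i) (delta C J) = scale (sg C J i) (delta C (flip J i)).
Proof.
apply/ffunP => K; rewrite clifford_base scaleE !deltaE.
case: (eqVneq K (flip J i)) => [->|nK].
  by rewrite mem_flip flipK eqxx addbT !eqxx sg_flip ltnn.
rewrite mulr0; case: ifP => // _; case: (eqVneq (flip K i) J) => [e|_]; last by rewrite mulr0.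
by case/eqP: nK; rewrite -e flipK.
Qed.

Lemma section_delta_coef J i : odd #|J| -> vcoef (s (delta C J)) (i \notin J) i = 0.
Proof.
move=> oddJ; have /ffunP/(_ (flip J i)) := section_kills (OG_delta oddJ).
rewrite clifford_delta spinor0 => /eqP; rewrite mulf_eq0 => /orP[|/eqP //].
by rewrite /sg signr_eq0.
Qed.

(** The sets [flip A i] and [flip A k] differ in two positions, so a move produces a combination of
    their basis spinors that lies on [OG_minus]. There s psi kills psi; the mixed terms of this
    equation, read at the set [flip J k], relate the two values of s. *)
Lemma section_compatible A i k : ~~ odd #|A| -> i != k ->
  sg C A i * vcoef (s (delta C (flip A i))) (i \notin A) i =
  sg C A k * vcoef (s (delta C (flip A k))) (k \notin A) k.
Proof.
move=> evA ik; set J := flip A i; set J' := flip A k.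
have oddJ : odd #|J| by rewrite odd_flip.
have oddJ' : odd #|J'| by rewrite odd_flip.
have J'E : J' = flip (flip J i) k by rewrite /J flipK.
pose e := sg C (flip J i) k * sg C J i.
pose x := base C (k \notin flip J i) k; pose y := base C (i \notin J) i.
have xyE : clifford x (clifford y (delta C J)) = scale e (delta C J').
  rewrite clifford_base_delta cliffordZr clifford_base_delta J'E.
  by apply/ffunP => K; rewrite !scaleE mulrA [sg C J i * _]mulrC.
have OGxy : OG_minus (delta C J + scale e (delta C J')).
  suff -> : delta C J + scale e (delta C J') = mv 1 x y (delta C J).
    rewrite /x /y; apply: OG_mv; last exact: OG_delta;
    rewrite bil_base vcoef_base ?(negPf ik) ?andbF //; by case: (_ \notin _).
  by apply/ffunP => K; rewrite mvE xyE mul1r spinorD.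
have e0 : e != 0 by rewrite mulf_neq0 // /sg signr_eq0.
have JJ' : J' != J.
  by apply: contraNneq ik => /setP/(_ i); rewrite !mem_flip eqxx; case: (i \in A); case: eqP.
have sE : s (delta C J + scale e (delta C J')) = s (delta C J) + e *: s (delta C J').
  rewrite section_linear // (bigD1 J) //= (bigD1 J') //= big1 => [|K /andP[/negPf KJ /negPf KJ']].
    by rewrite !spinorD !scaleE !deltaE eqxx (negPf JJ') eq_sym (negPf JJ') eqxx !mulr0 !mulr1 addr0 add0r scale1r addr0.
  by rewrite spinorD scaleE !deltaE KJ KJ' mulr0 addr0 scale0r.
have := section_kills OGxy; rewrite sE cliffordDl !cliffordDr !cliffordZl !cliffordZr.
rewrite !section_kills; try exact: OG_delta.
move=> /ffunP/(_ (flip J k)).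
rewrite !(spinorD, scaleE, spinor0) add0r !mulr0 addr0 -mulrDr => /eqP.
rewrite mulf_eq0 (negPf e0) /= clifford_delta.
have -> : flip J k = flip J' i by rewrite /J /J' flipC.
rewrite clifford_delta !mem_flip eq_sym (negPf ik) [k == i]eq_sym (negPf ik) !addbF.
set a := vcoef _ _ i; set a' := vcoef _ _ k => /eqP rel.
have anti := sg_flip_anti C A ik; rewrite -/J -/J' in anti.
have PP := sg_sq C J' i; have pp := sg_sq C A k.
have aE : a = - (sg C J' i * sg C J k * a').
  have -> : a = sg C J' i * (sg C J' i * a) by rewrite mulrA PP mul1r.
  by move/esym/eqP: rel; rewrite addr_eq0 => /eqP ->; ring.
rewrite aE; transitivity (- (sg C J' i * (sg C A i * sg C J k) * a')); first by ring.
rewrite anti; transitivity ((sg C J' i * sg C J' i) * (sg C A k * a')); first by ring.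
by rewrite PP mul1r.
Qed.

Lemma section_B : exists2 phi : spinor C, forall A, odd #|A| -> phi A = 0 &
  forall psi, OG_minus psi -> s psi = B phi psi.
Proof.
(* Any other index would give the same coefficient, by [section_compatible]; [ord0] serves as
   representative. *)
pose phi : spinor C := [ffun A : {set 'I_6} => if odd #|A| then 0 else
  sg C A ord0 * vcoef (s (delta C (flip A ord0))) (ord0 \notin A) ord0].
have phiE A i : ~~ odd #|A| ->
    sg C A i * vcoef (s (delta C (flip A i))) (i \notin A) i = phi A.
  move=> evA; rewrite ffunE (negPf evA); case: (eqVneq i ord0) => [->//|i0].
  exact: section_compatible.
have s_delta J : odd #|J| -> s (delta C J) = B phi (delta C J).
  move=> oddJ; apply: vcoef_inj => b i; rewrite vcoef_vec.
  case: (eqVneq b (i \in J)) => [->|bJ].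
    rewrite (bigD1 (flip J i)) /=; last by rewrite mem_flip eqxx addbT eqxx.
    rewrite big1 => [|A /andP[_ AJ]].
      rewrite addr0 -(phiE _ i) ?odd_flip ?oddJ // !flipK mem_flip eqxx addbT negbK.
      by rewrite deltaE eqxx mulr1 mulrC mulrA sg_sq mul1r.
    rewrite deltaE -(inj_eq (@flip_inj i)) flipK (negPf AJ) !mulr0 //.
  have -> : b = (i \notin J) by move: bJ; case: b; case: (i \in J).
  rewrite section_delta_coef // big1 // => A /eqP iA.
  rewrite deltaE; case: eqP => [e|]; last by rewrite !mulr0.
  by move: iA; rewrite -e mem_flip eqxx addbT negbK; case: (i \in A).
exists phi => [A oddA|psi OGpsi]; first by rewrite ffunE oddA.
have /OG_minusP[_ oddpsi _] := OGpsi.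
rewrite section_linear //; apply: vcoef_inj => b i; rewrite vcoef_sum vcoef_vec.
transitivity (\sum_J psi J * vcoef (B phi (delta C J)) b i).
  apply: eq_bigr => J _; rewrite vcoefZ; have [oddJ|evJ] := boolP (odd #|J|).
    by rewrite s_delta.
  by rewrite oddpsi // !mul0r.
under eq_bigr => J _ do rewrite vcoef_vec mulr_sumr.
rewrite exchange_big; apply: eq_bigr => A _ /=.
rewrite -(sum_delta psi (flip A i)) !mulr_sumr; apply: eq_bigr => J _.
by rewrite !deltaE eq_sym; ring.
Qed.

End Sections.

Section LinearForms.
Variables (C : fieldType) (I : finType).

Definition linear_form (m : I -> C) : coord_ring C I :=
  \sum_K m K *: 'X_(enum_rank K).

Lemma evalp_linear_form m (x : point C I) : evalp (linear_form m) x = \sum_K m K * x K.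
Proof.
rewrite /evalp /linear_form raddf_sum; apply: eq_bigr => K _.
by rewrite /= mevalZ mevalXU enum_rankK.
Qed.

Lemma linear_form_homog m : linear_form m \is 1.-homog.
Proof.
apply: rpred_sum => K _; apply: rpredZ.
by rewrite dhomogX /= mdeg1.
Qed.

End LinearForms.

Definition even_sets : {set {set 'I_6}} := [set A : {set 'I_6} | ~~ odd #|A|].

(** Values are taken in an arbitrary additive monoid, so that one construction yields both the
    spinor with given coordinates and the generic one, whose coordinates are variables. *)
Definition spinor_of (A : nmodType) (c : 'I_#|even_sets| -> A) : {ffun {set 'I_6} -> A} :=
  [ffun K => \sum_i if enum_val i == K then c i else 0].

Lemma spinor_of_enum (A : nmodType) (c : 'I_#|even_sets| -> A) i :
  spinor_of c (enum_val i) = c i.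
Proof.
rewrite ffunE (bigD1 i) //= eqxx big1 ?addr0 // => k ki.
by rewrite (inj_eq enum_val_inj) (negPf ki).
Qed.

Lemma spinor_of_odd (A : nmodType) (c : 'I_#|even_sets| -> A) (K : {set 'I_6}) :
  odd #|K| -> spinor_of c K = 0.
Proof.
move=> oddK; rewrite ffunE big1 // => i _; case: eqP => // e.
by have := enum_valP i; rewrite e inE oddK.
Qed.

Lemma spinor_ofK (A : nmodType) (phi : {ffun {set 'I_6} -> A}) :
  (forall K : {set 'I_6}, odd #|K| -> phi K = 0) -> spinor_of (fun i => phi (enum_val i)) = phi.
Proof.
move=> phi0; apply/ffunP => K; have [oddK|evK] := boolP (odd #|K|).
  by rewrite spinor_of_odd // phi0.
have KE : K \in even_sets by rewrite inE.
by rewrite -(enum_rankK_in KE KE) spinor_of_enum.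
Qed.

Lemma map_discriminant (A A' : comNzRingType) (f : {rmorphism A -> A'})
    (phi : {ffun {set 'I_6} -> A}) :
  discriminant (map_spinor f phi) = f (discriminant phi).
Proof.
have mapE K : map_spinor f phi K = f (phi K) by rewrite ffunE.
by rewrite /discriminant !mapE !(rmorphM, rmorphD, rmorphMn, rmorphXn).
Qed.

(** * The basis of sections and the genericity polynomial *)

Section Basis.
Variable C : numClosedFieldType.
Implicit Types (psi phi : spinor C) (c : 'I_#|even_sets| -> C).

Lemma B_basis_coef phi J i : vcoef (B phi (delta C J)) (i \in J) i = sg C J i * phi (flip J i).
Proof.
transitivity (bil (B phi (delta C J)) (base C (i \notin J) i)); first by rewrite bil_base negbK.
rewrite bilB clifford_base_delta (bigD1 (flip J i)) //= big1 => [|K /negPf KJ].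
  by rewrite scaleE deltaE eqxx mulr1 addr0 mulrC.
by rewrite scaleE deltaE KJ !mulr0.
Qed.

Definition spinor_section (i : 'I_#|even_sets|) psi : V C := B (delta C (enum_val i)) psi.

Lemma spinor_section_sum c psi :
  \sum_i c i *: spinor_section i psi = B (spinor_of c) psi.
Proof.
rewrite B_sum (bigID (mem even_sets)) /= [X in _ + X]big1 ?addr0 => [|K].
  by rewrite [RHS]big_enum_val; apply: eq_bigr => i _; rewrite spinor_of_enum.
by rewrite inE negbK => oddK; rewrite spinor_of_odd // scale0r.
Qed.

Lemma entry_vcoef (j : 'I_(6 + 6)) : exists b i, forall v : V C, v 0 j = vcoef v b i.
Proof.
case: (split_ordP j) => i ->; [exists true|exists false]; exists i => v; by rewrite /vcoef mxE.
Qed.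

Lemma B_linear phi (j : 'I_(6 + 6)) :
  exists m, forall psi, B phi psi 0 j = \sum_K m K * psi K.
Proof.
have [b [i vE]] := entry_vcoef j.
have [m mE] := spinor_linear_clifford (base C (~~ b) i).
exists (fun K => \sum_A phi A * m A K) => psi.
rewrite vE -{1}[b]negbK -bil_base bilB.
under eq_bigr => A _ do rewrite mE mulr_sumr.
rewrite exchange_big; apply: eq_bigr => K _ /=.
by rewrite mulr_suml; apply: eq_bigr => A _; rewrite mulrA.
Qed.

Lemma B_section phi : spinor_bundle_section (B phi).
Proof.
split=> [U psi maxU rU|psi0 OGpsi0]; first exact: represents_B.
exists 0%N, 1.
have [m mE] := fin_all_exists (B_linear phi).
exists (fun j => linear_form (m j)); split=> [|j||psi _].
- exact: dhomog1.
- exact: linear_form_homog.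
- by rewrite /evalp meval1 oner_neq0.
- rewrite /evalp meval1 scale1r; apply/rowP => j; rewrite [RHS]mxE mE.
  by rewrite -evalp_linear_form.
Qed.

Lemma spinor_section_basis : section_basis spinor_section.
Proof.
split=> [i|s s_sect|c c0 i].
- exact: B_section.
- have [phi phi0 sE] := section_B s_sect.
  exists (fun i => phi (enum_val i)) => psi OGpsi.
  by rewrite spinor_section_sum spinor_ofK // sE.
have evA := enum_valP i; rewrite inE in evA; pose J := flip (enum_val i) ord0.
have oddJ : odd #|J| by rewrite odd_flip.
have /(congr1 (fun v => vcoef v (ord0 \in J) ord0)) := c0 _ (OG_delta C oddJ).
rewrite spinor_section_sum B_basis_coef vcoef0 /J flipK spinor_of_enum => /esym/eqP.
by rewrite mulf_eq0 => /orP[|/eqP //]; rewrite /sg signr_eq0.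
Qed.

Definition generic_spinor := spinor_of (fun i : 'I_#|even_sets| => 'X_i : {mpoly C[#|even_sets|]}).

Lemma meval_genericity c : (genericity generic_spinor).@[c] = genericity (spinor_of c).
Proof.
have <- : map_spinor (meval c) generic_spinor = spinor_of c.
  apply/ffunP => K; rewrite !ffunE raddf_sum; apply: eq_bigr => i _ /=.
  by case: eqP => _; rewrite ?mevalXU ?meval0.
by rewrite /genericity map_pivots map_run map_discriminant mevalM.
Qed.

Definition bits_of_set (K : {set 'I_6}) : bits := mkseq (fun k => inord k \in K) 6.

Lemma set_of_bitsK s : size s = 6%N -> bits_of_set (set_of_bits s) = s.
Proof.
move=> s6; apply: (@eq_from_nth _ false); rewrite size_mkseq // => k lk.
by rewrite nth_mkseq // mem_set_of_bits inordK.
Qed.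

(** At 1 + e_0123 + e_0145 + e_2345 all pivots are 1 and all targets 0, so the reduction changes
    nothing, and the discriminant is 4. *)
Lemma genericity_neq0 : genericity generic_spinor != 0.
Proof.
pose four : seq bits := [:: s_; s0123; s0145; s2345].
pose phi : spinor C := [ffun K => (bits_of_set K \in four)%:R].
have phiE s : size s = 6%N -> phi (set_of_bits s) = (s \in four)%:R.
  by move=> s6; rewrite ffunE set_of_bitsK.
have odd_phi (K : {set 'I_6}) : odd #|K| -> phi K = 0.
  have [s s6 ->] := set_of_bits_surj K.
  have s6' : size s = 6%N.
    by apply/eqP; move: s s6; apply/allP; vm_compute.
  have -> : set_of_bits s = [set j : 'I_6 | nth false s j] by [].
  rewrite card_bits ?s6' // phiE // => odd_s; case: (boolP (s \in four)) => // sin.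
  by move: odd_s; rewrite /four !inE in sin; case/or4P: sin => /eqP ->.
apply: contra_eqN (meval_genericity (fun i => phi (enum_val i))) => /eqP ->.
rewrite meval0 spinor_ofK // eq_sym /genericity.
have [] := @run_fixed _ reduction phi.
  move=> st st_red; rewrite pivot_bits /target_index.
  have : [&& size (flip2 st st.2) == 6, flip2 st st.2 \in four, size st.2 == 6
           & st.2 \notin four] by move: st st_red; apply/allP; vm_compute.
  by case/and4P => /eqP sP inP /eqP sQ /negPf ninQ; rewrite !phiE // inP ninQ.
move=> -> ->; rewrite mul1r /discriminant !phiE //=.
by rewrite !mul1r expr0n add0r pnatr_eq0.
Qed.

End Basis.

(** * Decomposable spinors of degree k *)

Section EnumSet.
Implicit Types (J : {set 'I_6}) (i j : 'I_6).

Lemma sorted_enum_set J : sorted ltn (map val (enum J)).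
Proof.
rewrite sorted_map /enum_mem -enumT; apply: sorted_filter.
  by move=> a b c; apply: ltn_trans.
by rewrite -sorted_map val_enum_ord iota_ltn_sorted.
Qed.

(** Turns the Clifford sign at the k-th element of J into the sign (-1)^k of a Laplace expansion. *)
Lemma card_below_nth J k : (k < #|J|)%N ->
  #|[set l in J | (l < nth ord0 (enum J) k)%N]| = k.
Proof.
rewrite cardE => ltk; have := @count_lt_nth _ _ 0%N _ k (sorted_enum_set J).
rewrite size_map (nth_map ord0) // => /(_ ltk); rewrite count_map => e.
rewrite -[RHS]e -sum1dep_card -sum1_count big_enum_cond /=.
by apply: eq_bigl.
Qed.

Lemma nth_rem (T : eqType) (x0 : T) (s : seq T) (j m : nat) : uniq s -> (j < size s)%N ->
  nth x0 (rem (nth x0 s j) s) m = nth x0 s (bump j m).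
Proof.
move=> us ltj; rewrite remE index_uniq // nth_cat size_take ltj /bump [(j <= m)%N]leqNgt.
case: (ltnP m j) => mj /=; first by rewrite add0n nth_take.
by rewrite nth_drop addSn subnKC.
Qed.

Lemma enum_setD1 J i : enum (J :\ i) = rem i (enum J).
Proof.
rewrite rem_filter ?enum_uniq // /enum_mem -filter_predI; apply: eq_filter => l.
by rewrite /= !inE.
Qed.

End EnumSet.

Section Wedge.
Variable C : numFieldType.
Implicit Types (psi phi chi : spinor C) (v : V C) (J K A : {set 'I_6}).
Implicit Types (f g : 'I_6 -> C) (c : C).

Definition evec f : V C := vec (fun b i => if b then f i else 0).
Definition fvec g : V C := vec (fun b i => if b then 0 else g i).

Lemma bil_evec v f : bil v (evec f) = \sum_i vcoef v false i * f i.
Proof. by apply: eq_bigr => i _; rewrite !vcoef_vec mulr0 add0r. Qed.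

Lemma bil_fvec v g : bil v (fvec g) = \sum_i vcoef v true i * g i.
Proof. by apply: eq_bigr => i _; rewrite !vcoef_vec mulr0 addr0. Qed.

Lemma bil_evec_fvec f g : bil (evec f) (fvec g) = \sum_i f i * g i.
Proof. by rewrite bil_fvec; apply: eq_bigr => i _; rewrite vcoef_vec. Qed.

Lemma bil_evec2 f f' : bil (evec f) (evec f') = 0.
Proof. by rewrite bil_evec big1 // => i _; rewrite vcoef_vec mul0r. Qed.

Lemma evec_fvec v : v = evec (vcoef v true) + fvec (vcoef v false).
Proof. by apply: vcoef_inj => -[] i; rewrite vcoefD !vcoef_vec ?addr0 ?add0r. Qed.

Lemma clifford_evec f psi J :
  clifford (evec f) psi J = \sum_(i in J) sg C J i * (f i * psi (J :\ i)).
Proof.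
rewrite cliffordE [RHS]big_mkcond; apply: eq_bigr => i _; rewrite vcoef_vec /flip.
by case: ifP; rewrite ?mul0r ?mulr0.
Qed.

Fixpoint wedge k : 'M[C]_(k, 6) -> spinor C :=
  if k is k'.+1 then fun W => clifford (evec (W ord0)) (wedge (row' ord0 W))
  else fun=> delta C set0.

Definition minor_mx k (W : 'M[C]_(k, 6)) J : 'M[C]_k :=
  \matrix_(r, j) W r (nth ord0 (enum J) j).

(** Exterior multiplication by the first row is the Laplace expansion of the minors along that
    row. *)
Lemma wedge_minor k (W : 'M[C]_(k, 6)) J :
  wedge W J = if #|J| == k then \det (minor_mx W J) else 0.
Proof.
elim: k W J => [|k IHk] W J /=; first by rewrite deltaE det_mx00 cards_eq0; case: eqP.
rewrite clifford_evec; have [cardJ|ncardJ] := eqVneq #|J| k.+1; last first.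
  rewrite big1 // => i iJ; rewrite IHk; case: eqP => [e|_]; last by rewrite !mulr0.
  by move: ncardJ; rewrite (cardsD1 i) iJ e eqxx.
have sJ : size (enum J) = k.+1 by rewrite -cardE.
rewrite (expand_det_row _ ord0) -big_enum (big_nth ord0) sJ big_mkord /=.
apply: eq_bigr => j _; set e := nth _ _ _.
have eJ : e \in J by rewrite -mem_enum mem_nth // sJ.
have sgE : sg C J e = (-1) ^+ j by rewrite /sg card_below_nth // cardJ.
rewrite IHk (_ : #|J :\ e| == k); last by move/eqP: cardJ; rewrite (cardsD1 e) eJ.
rewrite sgE mulrCA /cofactor add0n mxE; congr (_ * (_ * \det _)).
apply/matrixP => r m; rewrite !mxE; congr (W _ _).
by rewrite enum_setD1 nth_rem ?enum_uniq // sJ.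
Qed.

Lemma row_free_minor k (W : 'M[C]_(k, 6)) J : wedge W J != 0 -> row_free W.
Proof.
rewrite wedge_minor; case: ifP => [_|_]; last by rewrite eqxx.
rewrite -unitfE -[_ \is a _]/(_ \in unitmx) => unitM; apply/row_freeP.
pose S : 'M[C]_(6, k) := \matrix_(i, j) (i == nth ord0 (enum J) j)%:R.
exists (S *m invmx (minor_mx W J)); rewrite mulmxA.
suff -> : W *m S = minor_mx W J by rewrite mulmxV.
apply/matrixP => r j; rewrite !mxE (bigD1 (nth ord0 (enum J) j)) //= big1 => [|i /negPf ij].
  by rewrite mxE eqxx mulr1 addr0.
by rewrite mxE ij mulr0.
Qed.

Lemma eq_evec f f' : f =1 f' -> evec f = evec f'.
Proof. by move=> e; apply: vcoef_inj => b i; rewrite !vcoef_vec e. Qed.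

Lemma wedge_evec k (W : 'M[C]_(k, 6)) r : clifford (evec (W r)) (wedge W) = 0.
Proof.
elim: k W r => [|k IHk] W r; first by case: r.
case: (unliftP ord0 r) => [r' ->|->] /=; last by rewrite clifford_sq0 // bil_evec2.
apply/ffunP => J; rewrite clifford_swap bil_evec2 mul0r sub0r spinor0.
rewrite (eq_evec (_ : W (lift ord0 r') =1 row' ord0 W r')) => [|i]; last by rewrite mxE.
by rewrite IHk clifford0r spinor0 oppr0.
Qed.

Lemma wedge_fvec k (W : 'M[C]_(k, 6)) g :
  (forall r, \sum_i W r i * g i = 0) -> clifford (fvec g) (wedge W) = 0.
Proof.
elim: k W => [|k IHk] W Wg /=; apply/ffunP => J; rewrite spinor0.
  rewrite cliffordE big1 // => i _; rewrite vcoef_vec deltaE /flip.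
  case: ifP => [_|iJ]; first by rewrite mul0r mulr0.
  by case: eqP => [/setP/(_ i)|]; rewrite ?mulr0 // !inE eqxx.
rewrite clifford_swap bilC bil_evec_fvec Wg mul0r sub0r IHk ?clifford0r ?spinor0 ?oppr0 // => r.
by rewrite -[RHS](Wg (lift ord0 r)); apply: eq_bigr => i _; rewrite mxE.
Qed.

(** The hypotheses make v orthogonal to the rows of W and to their annihilator in F. The first says
    that the F-part of v annihilates the rows, the second that its E-part is in the row space, and
    both kinds of vectors kill the product of the rows. *)
Lemma wedge_kills k (W : 'M[C]_(k, 6)) v :
  (forall r, bil v (evec (W r)) = 0) ->
  (forall g, (forall r, \sum_i W r i * g i = 0) -> bil v (fvec g) = 0) ->
  clifford v (wedge W) = 0.
Proof.
move=> vW vg; rewrite [v]evec_fvec cliffordDl wedge_fvec => [|r]; last first.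
  by rewrite -[RHS](vW r) bil_evec; apply: eq_bigr => i _; rewrite mulrC.
pose a : 'rV[C]_6 := \row_i vcoef v true i.
have /submxP[D aD] : (a <= W)%MS.
  rewrite submxE; apply/eqP/rowP => j; rewrite [RHS]mxE.
  have := vg (fun i => cokermx W i j); rewrite bil_fvec => <- => [|r].
    by rewrite mxE; apply: eq_bigr => i _; rewrite mxE.
  by have /matrixP/(_ r j) := mulmx_coker W; rewrite !mxE.
have -> : evec (vcoef v true) = \sum_r D 0 r *: evec (W r).
  apply: vcoef_inj => b i; rewrite vcoef_vec vcoef_sum.
  under eq_bigr => r _ do rewrite vcoefZ vcoef_vec.
  case: b; last by rewrite big1 // => r _; rewrite mulr0.
  by have /rowP/(_ i) := aD; rewrite !mxE.
rewrite clifford_suml big1 ?addr0 // => r _.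
by rewrite cliffordZl wedge_evec; apply/ffunP => J; rewrite scaleE spinor0 mulr0.
Qed.

Lemma pure_wedge k (W : 'M[C]_(k, 6)) : pure (wedge W).
Proof.
move=> phi; apply: wedge_kills => [r|g Wg]; rewrite bilB big1 // => A _.
  by rewrite wedge_evec spinor0 mulr0.
by rewrite wedge_fvec // spinor0 mulr0.
Qed.

(** The columns of a right inverse are dual to the rows: contraction by the first column removes the
    first row from the product, which allows an induction down to the empty product 1. *)
Lemma wedge_neq0 k (W : 'M[C]_(k, 6)) : row_free W -> wedge W != 0.
Proof.
case/row_freeP; elim: k W => [|k IHk] W D WD; first exact: delta_neq0.
have WDE r l : \sum_i W r i * D i l = (r == l)%:R.
  by have /matrixP/(_ r l) := WD; rewrite !mxE.
have W'D' : row' ord0 W *m col' ord0 D = 1%:M.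
  apply/matrixP => r l; rewrite !mxE -(inj_eq (@lift_inj _ ord0)) -WDE.
  by apply: eq_bigr => i _; rewrite !mxE.
apply: contra_neqN (IHk _ _ W'D') => /eqP W0; apply/ffunP => J; rewrite spinor0.
have /ffunP/(_ J) : clifford (fvec (fun i => D i ord0)) (wedge W) = 0 by rewrite W0 clifford0r.
rewrite spinor0 /= clifford_swap bilC bil_evec_fvec WDE eqxx mul1r.
rewrite wedge_fvec ?clifford0r ?spinor0 ?subr0 // => r.
by rewrite -[RHS](WDE (lift ord0 r) ord0); apply: eq_bigr => i _; rewrite mxE.
Qed.

Lemma OG_wedge (W : 'M[C]_(3, 6)) : row_free W -> OG_minus (wedge W).
Proof.
move=> freeW; apply/OG_minusP; split; [exact: wedge_neq0| |exact: pure_wedge].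
by move=> J; rewrite wedge_minor; case: eqP => [->|].
Qed.

(** Recursion on the distance from J to J0. With A = [flip J0 i] and K = [flip J i], for i in the
    difference, the equation at K of [B (delta A) psi] acting on chi expresses psi J0 * chi J
    through values of chi at sets closer to J0. As psi satisfies the same equations, chi is
    proportional to it. *)
Lemma pure_unique psi chi J0 : pure psi -> psi J0 != 0 ->
  (forall i, clifford (B (delta C (flip J0 i)) psi) chi = 0) ->
  forall J, psi J0 * chi J = chi J0 * psi J.
Proof.
move=> purepsi psi0 kills J.
have [n] := ubnP #|[set i | (i \in J) != (i \in J0)]|.
elim: n J => // n IHn J; rewrite ltnS => le_n.
have [JJ0|/eqP/setP-neq] := eqVneq J J0; first by rewrite JJ0 mulrC.
have [i Ji] : exists i, (i \in J) != (i \in J0).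
  apply/existsP; apply: contra_notT neq; rewrite negb_exists => /forallP e i.
  by apply/eqP; have := e i; rewrite negbK.
pose A := flip J0 i; pose K := flip J i.
have AK m : ((m \in A) != (m \in K)) = ((m \in J) != (m \in J0)).
  by rewrite !mem_flip; case: (m == i); case: (m \in J); case: (m \in J0).
pose rest (xi : spinor C) := \sum_(m | ((m \in J) != (m \in J0)) && (m != i))
  sg C K m * (sg C A m * psi (flip A m) * xi (flip K m)).
have rel (xi : spinor C) : clifford (B (delta C A) psi) xi = 0 ->
    sg C K i * (sg C A i * psi J0 * xi J) = - rest xi.
  move=> /ffunP/(_ K); rewrite spinor0 cliffordE => e; apply/eqP; rewrite -addr_eq0 -[X in _ == X]e.
  apply/eqP; rewrite [RHS](bigID (fun m => (m \in J) != (m \in J0))) /=.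
  rewrite [X in _ = _ + X]big1 ?addr0 => [|m]; last first.
    rewrite -(AK m) negbK => /eqP mm; rewrite B_delta mm; case: (m \in K); rewrite mul0r mulr0 //.
  rewrite (bigD1 i) //=; congr (_ + _).
    by rewrite B_delta /A /K !flipK -/A -/K; have := AK i; rewrite Ji; case: (i \in A); case: (i \in K).
  apply: eq_bigr => m /andP[Jm _]; have := AK m; rewrite Jm B_delta.
  by case: (m \in A); case: (m \in K).
have IH m : ((m \in J) != (m \in J0)) && (m != i) ->
    psi J0 * chi (flip K m) = chi J0 * psi (flip K m).
  case/andP => Jm mi; apply: IHn; apply: leq_trans le_n; apply: proper_card.
  rewrite properE; apply/andP; split.
    apply/subsetP => l; rewrite !inE /K !mem_flip.
    case: (eqVneq l m) => [->|_]; first by rewrite Jm.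
    by case: (eqVneq l i) => [->|_]; rewrite ?Ji // !addbF.
  apply/subsetPn; exists i; rewrite inE // /K !mem_flip eqxx [i == m]eq_sym (negPf mi) addbF addbT.
  by move: Ji; case: (i \in J); case: (i \in J0).
have rest_eq : psi J0 * rest chi = chi J0 * rest psi.
  rewrite !mulr_sumr; apply: eq_bigr => m /IH e.
  transitivity (sg C K m * (sg C A m * psi (flip A m)) * (psi J0 * chi (flip K m))); first by ring.
  by rewrite e; ring.
have relpsi := rel psi (purepsi _); have relchi := rel chi (kills i).
have s0 : sg C K i * sg C A i * psi J0 != 0 by rewrite !mulf_neq0 // /sg signr_eq0.
apply: (mulfI s0).
transitivity (psi J0 * (sg C K i * (sg C A i * psi J0 * chi J))); first by ring.
rewrite relchi mulrN rest_eq -mulrN -relpsi.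
by ring.
Qed.

End Wedge.

(** * Pure spinors of degree 3 and the Grassmannian *)

Section CubicSpinors.
Variable C : numClosedFieldType.
Implicit Types (psi : spinor C) (J K A : {set 'I_6}) (i j e : 'I_6).

Definition cubic psi : Prop := forall K : {set 'I_6}, #|K| != 3 -> psi K = 0.

Lemma cubic_wedge (W : 'M[C]_(3, 6)) : cubic (wedge W).
Proof. by move=> K /negPf K3; rewrite wedge_minor K3. Qed.

Lemma OG_scale c psi : c != 0 -> OG_minus psi -> OG_minus (scale c psi).
Proof.
move=> c0 /OG_minusP[psi0 oddpsi purepsi]; apply/OG_minusP; split.
- have [J psiJ] := spinor_neq0 psi0; apply/eqP => /ffunP/(_ J)/eqP.
  by rewrite scaleE spinor0 mulf_eq0 (negPf c0) (negPf psiJ).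
- by move=> J evJ; rewrite scaleE oddpsi // mulr0.
- suff -> : scale c psi = weight ord0 c c psi by apply: pure_weight.
  by apply/ffunP => J; rewrite !ffunE if_same.
Qed.

Lemma minor_one k (W : 'M[C]_(k, 6)) J : #|J| = k ->
  (forall r (l : 'I_k), W r (nth ord0 (enum J) l) = (r == l)%:R) -> wedge W J = 1.
Proof.
move=> cardJ WJ; rewrite wedge_minor cardJ eqxx.
suff -> : minor_mx W J = 1%:M by rewrite det1.
by apply/matrixP => r l; rewrite !mxE WJ.
Qed.

(** Multiplying the product of the rows by its own row W r gives 0. At the set J with i added, only
    the terms that remove i and e survive. *)
Lemma wedge_row (W : 'M[C]_(3, 6)) r J i e : e \in J -> i \notin J -> W r e = 1 ->
  (forall m, m \in J -> m != e -> W r m = 0) ->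
  wedge W (flip (flip J i) e) =
    - (sg C (flip J i) i * sg C (flip J i) e * W r i * wedge W J).
Proof.
move=> eJ iJ We W0; set A := flip J i.
have ie : e != i by apply: contraNneq iJ => <-.
have iA : i \in A by rewrite mem_flip eqxx addbT.
have eA : e \in A by rewrite mem_flip (negPf ie) addbF.
have /ffunP/(_ A) := wedge_evec W r; rewrite clifford_evec spinor0.
rewrite (bigD1 i) //= (bigD1 e) /=; last by rewrite eA.
rewrite big1 => [|m /andP[/andP[mA mi] me]]; last first.
  rewrite W0 ?mul0r ?mulr0 //; move: mA; by rewrite mem_flip (negPf mi) addbF.
have -> : A :\ i = J by rewrite /A /flip (negPf iJ) setU1K.
have -> : A :\ e = flip A e by rewrite /flip eA.
rewrite We mul1r addr0 => /eqP; rewrite addr_eq0 => /eqP rel.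
have see := sg_sq C A e.
transitivity (sg C A e * (sg C A e * wedge W (flip A e))); first by rewrite mulrA see mul1r.
transitivity (- (sg C A e * - (sg C A e * wedge W (flip A e)))); first by ring.
by rewrite -rel; ring.
Qed.

Lemma mem_enum_nth J k e : #|J| = k -> e \in J ->
  exists r : 'I_k, nth ord0 (enum J) r = e.
Proof.
move=> cardJ eJ; have lt_e : (index e (enum J) < k)%N.
  by rewrite -cardJ cardE index_mem mem_enum.
by exists (Ordinal lt_e); rewrite /= nth_index // mem_enum.
Qed.

Lemma enum_nth_eq J k (r l : 'I_k) : #|J| = k ->
  (nth ord0 (enum J) r == nth ord0 (enum J) l) = (r == l).
Proof. by move=> cardJ; rewrite nth_uniq ?enum_uniq // -cardE cardJ. Qed.

Lemma enum_nth_mem J k (r : 'I_k) : #|J| = k -> nth ord0 (enum J) r \in J.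
Proof. by move=> cardJ; rewrite -mem_enum mem_nth // -cardE cardJ. Qed.

(* The affine chart of G(3, 6) around e_J. *)
Lemma chart_point J (y : {set 'I_6} -> C) : #|J| = 3 -> y J != 0 ->
  exists psi, [/\ OG_minus psi, cubic psi, psi J = y J
    & forall i e, i \notin J -> e \in J ->
        psi (flip (flip J i) e) = y (flip (flip J i) e)].
Proof.
move=> cardJ yJ; pose e_ (r : 'I_3) := nth ord0 (enum J) r.
(* Echelon form: the identity on the columns in J, elsewhere the prescribed ratios with the signs of
   [wedge_row]. *)
pose W : 'M[C]_(3, 6) := \matrix_(r, i) if i \in J then (i == e_ r)%:R else
  - (sg C (flip J i) i * sg C (flip J i) (e_ r) * (y (flip (flip J i) (e_ r)) / y J)).
have WJ r l : W r (e_ l) = (r == l)%:R.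
  by rewrite mxE (enum_nth_mem l cardJ) enum_nth_eq // eq_sym.
have W1 : wedge W J = 1 by apply: minor_one.
have freeW : row_free W by apply: (@row_free_minor _ _ _ J); rewrite W1 oner_neq0.
exists (scale (y J) (wedge W)); split.
- exact/OG_scale/OG_wedge.
- by move=> K K3; rewrite scaleE cubic_wedge // mulr0.
- by rewrite scaleE W1 mulr1.
move=> i e iJ eJ; have [r er] := mem_enum_nth cardJ eJ; rewrite scaleE.
rewrite (wedge_row (r := r) eJ iJ) => [||m mJ me]; last 2 first.
- by rewrite -er WJ eqxx.
- by rewrite mxE mJ /e_ er (negPf me).
rewrite W1 mulr1 mxE (negPf iJ) /e_ er.
have si := sg_sq C (flip J i) i; have se := sg_sq C (flip J i) e.
set s := sg C _ i; set s' := sg C _ e; rewrite -/s -/s' in si se.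
transitivity (y J * ((s * s) * (s' * s') * (y (flip (flip J i) e) / y J))); first by ring.
by rewrite si se !mul1r mulrC divfK.
Qed.

(** Of the six vectors [v i] that span the subspace of psi, those with i in J lie in E, since their
    F-parts read psi in degree 1; the others lie in F, since their E-parts read degree 5. The three
    in E, normalized on J, are the rows of a matrix whose wedge is killed by all six, and
    [pure_unique] identifies it with psi up to a scalar. *)
Lemma cubic_decomposable psi : OG_minus psi -> cubic psi ->
  exists2 W : 'M[C]_(3, 6), row_free W & psi = wedge W.
Proof.
move=> /OG_minusP[psi0 oddpsi purepsi] cub.
have [J psiJ] := spinor_neq0 psi0.
have cardJ : #|J| = 3 by apply/eqP; apply: contraNT psiJ => /cub ->.
pose e_ (r : 'I_3) := nth ord0 (enum J) r.
pose v i : V C := B (delta C (flip J i)) psi.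
have v_in i : i \in J -> forall l, vcoef (v i) false l = 0.
  move=> iJ l; rewrite B_delta; case: ifP => // /eqP lA.
  rewrite cub ?mulr0 // {1}/flip lA.
  have : l \in flip J i by [].
  rewrite /flip iJ => lJ; move: cardJ; rewrite (cardsD1 i) iJ (cardsD1 l) lJ !add1n.
  by case=> ->.
have v_out i : i \notin J -> forall l, vcoef (v i) true l = 0.
  move=> iJ l; rewrite B_delta; case: ifP => // /eqP /negbT lA.
  rewrite cub ?mulr0 // {1}/flip (negPf lA) cardsU1 lA /flip (negPf iJ) cardsU1 iJ cardJ //.
pose W : 'M[C]_(3, 6) := \matrix_(r, i) ((sg C J (e_ r) * psi J)^-1 * vcoef (v (e_ r)) true i).
have sgn0 i : sg C J i != 0 by rewrite /sg signr_eq0.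
have evecW r : evec (W r) = (sg C J (e_ r) * psi J)^-1 *: v (e_ r).
  apply: vcoef_inj => b i; rewrite vcoef_vec vcoefZ; case: b; first by rewrite mxE.
  by rewrite v_in ?mulr0 // enum_nth_mem.
have vE r : v (e_ r) = (sg C J (e_ r) * psi J) *: evec (W r).
  by rewrite evecW scalerA mulfV ?scale1r // mulf_neq0.
have WJ r l : W r (e_ l) = (r == l)%:R.
  rewrite mxE B_delta mem_flip enum_nth_mem //= enum_nth_eq // eq_sym.
  case: (eqVneq r l) => [->|_]; last by rewrite mulr0.
  by rewrite sg_flip ltnn flipK mulVf // mulf_neq0.
have W1 : wedge W J = 1 by apply: minor_one.
have kills i : clifford (v i) (wedge W) = 0.
  have [iJ|iJ] := boolP (i \in J).
    have [r <-] := mem_enum_nth cardJ iJ; rewrite -/(e_ r) vE cliffordZl wedge_evec.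
    by apply/ffunP => K; rewrite scaleE spinor0 mulr0.
  have vE' : fvec (vcoef (v i) false) = v i.
    by apply: vcoef_inj => -[] l; rewrite [LHS]vcoef_vec // v_out.
  rewrite -vE'; apply: wedge_fvec => r; rewrite -bil_evec_fvec vE'.
  by rewrite evecW bilZl (orthogonal_of_kills psi0) ?mulr0 //; apply: purepsi.
have psiE : psi = scale (psi J) (wedge W).
  by apply/ffunP => K; rewrite scaleE (pure_unique purepsi psiJ kills) W1 mul1r.
(* The scalar psi J is absorbed into the first row. *)
pose W' : 'M[C]_(3, 6) := \matrix_(r, i) if r == ord0 then psi J * W r i else W r i.
have W'E : psi = wedge W'.
  rewrite {1}psiE /= -cliffordZl; congr (clifford _ _).
    by apply: vcoef_inj => b i; rewrite vcoefZ !vcoef_vec; case: b; rewrite ?mulr0 // [RHS]mxE eqxx.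
  have r'E : row' ord0 W = row' ord0 W' by apply/matrixP => r i; rewrite !mxE.
  by rewrite -[in RHS]r'E.
exists W' => //; apply: (@row_free_minor _ _ _ J).
by rewrite -W'E.
Qed.

Lemma plucker_wedge k (W : 'M[C]_(k, 6)) (L : {J : {set 'I_6} | #|J| == k}) :
  plucker W L = wedge W (val L).
Proof.
rewrite wedge_minor (valP L) ffunE; congr (\det _).
apply/matrixP => r l; rewrite !mxE; congr (W _ _).
by rewrite (enum_val_nth ord0).
Qed.

Lemma B_diagonal a b psi i :
  vcoef (B (diagonal a b) psi) true i = a * (sg C set0 i * psi (flip set0 i)) /\
  vcoef (B (diagonal a b) psi) false i = b * (sg C setT i * psi (flip setT i)).
Proof.
have T0 : (setT == set0 :> {set 'I_6}) = false.
  by apply/eqP => /setP/(_ i); rewrite !inE.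
split; rewrite vcoef_vec.
  rewrite (bigD1 set0) /=; last by rewrite inE.
  rewrite ffunE eqxx big1 ?addr0 // => A /andP[iA A0]; rewrite ffunE (negPf A0).
  by case: (eqVneq A setT) iA => [->|_ _]; rewrite ?inE // mul0r.
rewrite (bigD1 setT) /=; last by rewrite inE.
rewrite ffunE T0 eqxx big1 ?addr0 // => A /andP[iA AT]; rewrite ffunE (negPf AT).
by case: (eqVneq A set0) iA => [->|_ _]; rewrite ?inE // mul0r.
Qed.

Lemma odd_not_cubic (K : {set 'I_6}) : odd #|K| -> #|K| != 3 ->
  exists i, K = flip set0 i \/ K = flip setT i.
Proof.
move=> oddK K3; have := max_card K; rewrite card_ord.
have : (#|K| == 1)%N || (#|~: K| == 1)%N.
  have := cardsC K; rewrite card_ord; move: oddK K3.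
  by case: #|K| => [|[|[|[|[|[|[|m]]]]]]] //= _ _; rewrite !addSn ?add0n // => -[->].
case/orP => /cards1P[i Ki] _; exists i; [left|right]; apply/setP => k.
  by rewrite Ki mem_flip !inE.
by rewrite -[K]setCK Ki mem_flip !inE; case: (k == i).
Qed.

Lemma B_diagonal_eq0 a b psi : a != 0 -> b != 0 -> odd_spinor psi ->
  B (diagonal a b) psi = 0 <-> cubic psi.
Proof.
move=> a0 b0 oddpsi; have s0 J i : sg C J i != 0 by rewrite /sg signr_eq0.
split=> [B0 K K3|cub].
  have [oddK|evK] := boolP (odd #|K|); last exact: oddpsi.
  have [i [] ->] := odd_not_cubic oddK K3; have [h1 h2] := B_diagonal a b psi i.
    move: h1; rewrite B0 vcoef0 => /esym/eqP.
    by rewrite !mulf_eq0 (negPf a0) (negPf (s0 _ _)) /= => /eqP.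
  move: h2; rewrite B0 vcoef0 => /esym/eqP.
  by rewrite !mulf_eq0 (negPf b0) (negPf (s0 _ _)) /= => /eqP.
apply: vcoef_inj => d i; rewrite vcoef0; have [h1 h2] := B_diagonal a b psi i.
case: d; rewrite ?h1 ?h2 cub ?mulr0 // /flip !inE.
  by rewrite cardsU1 !inE cards0.
by have := cardsD1 i setT; rewrite cardsT card_ord !inE add1n => -[<-].
Qed.

End CubicSpinors.

(** * The zero scheme *)

Section Kronecker.
Variable C : numFieldType.

Lemma base_expansion_inj n D (a b : 'I_n -> nat) :
  (forall i, a i < D)%N -> (forall i, b i < D)%N ->
  (\sum_i a i * D ^ i = \sum_i b i * D ^ i)%N -> a =1 b.
Proof.
elim: n a b => [|n IHn] a b aD bD; first by move=> _ [].
have D0 : (0 < D)%N by apply: leq_trans (aD ord0).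
have shift (c : 'I_n.+1 -> nat) : (\sum_i c i * D ^ i)%N =
    ((\sum_(i < n) c (lift ord0 i) * D ^ i) * D + c ord0)%N.
  rewrite big_ord_recl expn0 muln1 addnC; congr (_ + _)%N.
  by rewrite big_distrl; apply: eq_bigr => i _; rewrite /= expnS mulnA mulnAC.
rewrite !shift => e.
have e0 : a ord0 = b ord0.
  by have := congr1 (modn^~ D) e; rewrite !modnMDl !modn_small.
have /IHn e1 : (\sum_(i < n) a (lift ord0 i) * D ^ i = \sum_(i < n) b (lift ord0 i) * D ^ i)%N.
  by have := congr1 (divn^~ D) e; rewrite !divnMDl // !divn_small // !addn0.
move=> i; case: (unliftP ord0 i) => [j ->|-> //].
by apply: e1.
Qed.

(** Kronecker substitution of t^(D^i) for the i-th variable: D exceeds every exponent, so distinct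
    monomials go to distinct powers of t. *)
Lemma mpoly_eval0 n (p : {mpoly C[n]}) : (forall v, p.@[v] = 0) -> p = 0.
Proof.
move=> p0; pose D := (msize p).+1.
pose wt (m : 'X_{1..n}) := (\sum_(i < n) m i * D ^ i)%N.
pose P : {poly C} := \sum_(m <- msupp p) p@_m *: 'X^(wt m).
have P0 : P = 0.
  apply: poly_eval0 => t; rewrite -(p0 (fun i : 'I_n => t ^+ (D ^ i)%N)) mevalE horner_sum.
  apply: eq_bigr => m _; rewrite hornerZ hornerXn; congr (_ * _).
  by rewrite -prodrXr; apply: eq_bigr => i _; rewrite -exprM mulnC.
have bound m : m \in msupp p -> forall i, (m i < D)%N.
  move=> mp i; rewrite ltnS (leq_trans _ (ltnW (msize_mdeg_lt mp))) //.
  by rewrite mdegE (bigD1 i) //= leq_addr.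
apply/mpolyP => m; rewrite mcoeff0; case: (boolP (m \in msupp p)) => [mp|]; last exact: memN_msupp_eq0.
have := congr1 (fun q : {poly C} => q`_(wt m)) P0.
rewrite coef0 coef_sum (bigD1_seq m) ?msupp_uniq //= big_seq_cond big1 => [|m' /andP[m'p m'm]].
  by rewrite addr0 coefZ coefXn eqxx mulr1.
rewrite coefZ coefXn; case: eqP => [e|_]; last by rewrite mulr0.
case/eqP: m'm; apply/mnmP => i.
by apply: (base_expansion_inj (bound _ m'p) (bound _ mp) (esym e)).
Qed.

Lemma evalp_eq0 (I : finType) (F : coord_ring C I) : (forall x, evalp F x = 0) -> F = 0.
Proof.
move=> F0; apply: mpoly_eval0 => v; rewrite -(F0 [ffun K => v (enum_rank K)]).
by apply: meval_eq => i; rewrite ffunE enum_valK.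
Qed.

End Kronecker.

Section GeneratedIdeal.
Variables (A : comNzRingType) (S : A -> Prop).

Lemma ideal_gen F : S F -> generated_ideal S F.
Proof.
move=> SF; exists [:: (1, F)]; split; last by rewrite big_seq1 mul1r.
by move=> a; rewrite inE => /eqP ->.
Qed.

Lemma ideal0 : generated_ideal S 0.
Proof. by exists [::]; split=> //; rewrite big_nil. Qed.

Lemma idealD F G : generated_ideal S F -> generated_ideal S G -> generated_ideal S (F + G).
Proof.
move=> [r [Sr ->]] [r' [Sr' ->]]; exists (r ++ r'); split; last by rewrite big_cat.
by move=> a; rewrite mem_cat => /orP[/Sr|/Sr'].
Qed.

Lemma idealM F G : generated_ideal S G -> generated_ideal S (F * G).
Proof.
move=> [r [Sr ->]]; exists [seq (F * a.1, a.2) | a <- r]; split.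
  by move=> a /mapP[b br ->]; exact: (Sr b br).
by rewrite big_map mulr_sumr; apply: eq_bigr => a _; rewrite mulrA.
Qed.

Lemma ideal_sum (I : finType) (P : pred I) (F : I -> A) :
  (forall i, P i -> generated_ideal S (F i)) -> generated_ideal S (\sum_(i | P i) F i).
Proof.
by move=> SF; apply: big_ind => //; [exact: ideal0 | exact: idealD].
Qed.

Lemma ideal_congrM F F' G G' : generated_ideal S (F - F') -> generated_ideal S (G - G') ->
  generated_ideal S (F * G - F' * G').
Proof.
move=> SF SG; have -> : F * G - F' * G' = F * (G - G') + G' * (F - F') by ring.
by apply: idealD; apply: idealM.
Qed.

Lemma ideal_congrX F G k : generated_ideal S (F - G) -> generated_ideal S (F ^+ k - G ^+ k).
Proof.
move=> SFG; elim: k => [|k IHk]; first by rewrite !expr0 subrr; exact: ideal0.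
by rewrite !exprS; apply: ideal_congrM.
Qed.

End GeneratedIdeal.

(** * Zero locus and zero scheme of a section equivalent to a diagonal one *)

Section ZeroLocus.
Variable C : numClosedFieldType.
Implicit Types (psi : spinor C) (A J K : {set 'I_6}) (F G : coord_ring C {set 'I_6}).
Variables (s : spinor C -> V C) (phi : spinor C) (a b : C).
Variables (g g' : spinor C -> spinor C).
Hypotheses (a0 : a != 0) (b0 : b != 0).
Hypothesis (sE : forall psi, OG_minus psi -> s psi = B phi psi).
Hypotheses (gK : cancel g g') (g'K : cancel g' g).
Hypothesis (g_inter : intertwines g phi (diagonal a b)).
Hypothesis (g'_inter : intertwines g' (diagonal a b) phi).

Lemma OG_odd psi : OG_minus psi -> odd_spinor psi.
Proof. by case/OG_minusP. Qed.

Lemma zero_locusE psi : zero_locus s psi <-> OG_minus psi /\ cubic (g psi).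
Proof.
have [_ gOG gB] := g_inter; have [_ _ g'B] := g'_inter.
have B_eq0 psi' chi phi' phi'' :
    (forall w, exists u, bil (B phi'' chi) w = bil (B phi' psi') u) ->
    B phi' psi' = 0 -> B phi'' chi = 0.
  move=> H e; apply: bil_inj => w; have [u ->] := H w; rewrite e.
  by rewrite -(scale0r (0 : V C)) !bilZl !mul0r.
split=> -[OGpsi h]; split=> //.
  apply/(B_diagonal_eq0 a0 b0 (OG_odd (gOG _ OGpsi))).
  apply: (B_eq0 psi _ phi) => [w|]; first by have [u Hu] := gB w; exists u; rewrite Hu.
  by rewrite -sE.
rewrite sE // -[psi]gK; apply: (B_eq0 (g psi) _ (diagonal a b)) => [w|].
  by have [u Hu] := g'B w; exists u; rewrite Hu.
exact/(B_diagonal_eq0 a0 b0 (OG_odd (gOG _ OGpsi))).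
Qed.

Lemma cubic_lift psi : OG_minus psi -> cubic psi -> zero_locus s (g' psi).
Proof.
move=> OGpsi cub; apply/zero_locusE; rewrite g'K; split=> //.
by have [_ g'OG _] := g'_inter; apply: g'OG.
Qed.

Definition restrict3 psi : point C {J : {set 'I_6} | #|J| == 3} := [ffun L => psi (val L)].

Definition extend3 (p : point C {J : {set 'I_6} | #|J| == 3}) : spinor C :=
  [ffun K => \sum_L (val L == K)%:R * p L].

Lemma extend3_val p L : extend3 p (val L) = p L.
Proof.
rewrite ffunE (bigD1 L) //= eqxx mul1r big1 ?addr0 // => M /negPf ML.
by rewrite (inj_eq val_inj) ML mul0r.
Qed.

Lemma restrict3K psi : cubic psi -> extend3 (restrict3 psi) = psi.
Proof.
move=> cub; apply/ffunP => K; have [K3|K3] := boolP (#|K| == 3).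
  by rewrite -[K]/(val (exist (fun J : {set 'I_6} => #|J| == 3) K K3)) extend3_val ffunE.
rewrite cub // ffunE big1 // => L _; case: eqP => [e|_]; last by rewrite mul0r.
by move: K3; rewrite -e (valP L).
Qed.

Lemma extend3K p : restrict3 (extend3 p) = p.
Proof. by apply/ffunP => L; rewrite ffunE extend3_val. Qed.

Lemma restrict3_wedge (W : 'M[C]_(3, 6)) : restrict3 (wedge W) = plucker W.
Proof. by apply/ffunP => L; rewrite plucker_wedge ffunE. Qed.

Lemma same_line_refl (I : finType) (x : point C I) : same_line x x.
Proof. by exists 1; rewrite ?oner_neq0 // => i; rewrite mul1r. Qed.

Lemma linear_regular_map (I J : finType) (X : point C I -> Prop) (Y : point C J -> Prop)
    (f : point C I -> point C J) (m : J -> I -> C) :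
  (forall x j, f x j = \sum_i m j i * x i) -> (forall x, X x -> Y (f x)) ->
  (forall x, X x -> f x != 0) -> regular_map X Y f.
Proof.
move=> fE XY f0; split=> // x0 Xx0; exists 1%N, (fun j => linear_form (m j)).
have formE x : [ffun j => evalp (linear_form (m j)) x] = f x.
  by apply/ffunP => j; rewrite ffunE evalp_linear_form fE.
split=> [j||x _ _]; [exact: linear_form_homog|by rewrite formE f0|].
by rewrite formE; apply: same_line_refl.
Qed.

(** Both maps are restrictions of linear ones: g followed by the projection to degree 3, and
    extension by zero followed by g'. *)
Lemma zero_locus_isomorphic : isomorphic_varieties (zero_locus s) (@grassmannian C 3 6).
Proof.
have [[m gE] gOG _] := g_inter; have [[m' g'E] g'OG _] := g'_inter.
exists (fun psi => restrict3 (g psi)), (fun p => g' (extend3 p)).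
have Zwedge psi : zero_locus s psi -> exists2 W : 'M[C]_(3, 6), row_free W & g psi = wedge W.
  by move=> /zero_locusE[OGpsi cub]; apply: cubic_decomposable => //; apply: gOG.
have restrict3_neq0 (W : 'M[C]_(3, 6)) : row_free W -> restrict3 (wedge W) != 0.
  move=> freeW; apply: contra_neq (wedge_neq0 freeW) => e.
  rewrite -(restrict3K (cubic_wedge W)) e; apply/ffunP => K.
  by rewrite !ffunE big1 // => L _; rewrite ffunE mulr0.
split.
- apply: (@linear_regular_map _ _ _ _ _ (fun L K => m (val L) K)).
  + by move=> psi L; rewrite ffunE gE.
  + by move=> psi /Zwedge[W freeW ->]; exists W => //; apply: restrict3_wedge.
  + by move=> psi /Zwedge[W freeW ->]; apply: restrict3_neq0.
- have ZW p : grassmannian p -> zero_locus s (g' (extend3 p)).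
    move=> [W freeW ->]; rewrite -restrict3_wedge restrict3K; last exact: cubic_wedge.
    by apply: cubic_lift; [apply: OG_wedge | apply: cubic_wedge].
  apply: (@linear_regular_map _ _ _ _ _ (fun K L => m' K (val L))).
  + move=> p K; rewrite g'E; under eq_bigr => J _ do rewrite ffunE mulr_sumr.
    rewrite exchange_big; apply: eq_bigr => L _ /=.
    rewrite (bigD1 (val L)) //= eqxx mul1r big1 ?addr0 // => J.
    by rewrite eq_sym => /negPf ->; rewrite mul0r mulr0.
  + exact: ZW.
  + by move=> p /ZW[/OG_minusP[]].
- by move=> psi /zero_locusE[_ cub]; rewrite restrict3K // gK; apply: same_line_refl.
- by move=> p _; rewrite g'K extend3K; apply: same_line_refl.
Qed.

Let I_s := zero_scheme_ideal s.

Lemma ideal_OG F : (forall psi, OG_minus psi -> evalp F psi = 0) -> I_s F.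
Proof. by move=> F0; apply: ideal_gen; left. Qed.

Lemma ideal_vanish F psi : I_s F -> zero_locus s psi -> evalp F psi = 0.
Proof.
move=> [r [Sr ->]] [OGpsi s0]; rewrite /evalp raddf_sum big_seq big1 // => c cr /=.
rewrite mevalM; suff -> : c.2.@[fun i => psi (enum_val i)] = 0 by rewrite mulr0.
have [c0|[d [q [j [_ _ cq]]]]] := Sr c cr; first exact: c0.
by rewrite -/(evalp c.2 psi) cq // s0 mxE mulr0.
Qed.

Lemma bil_entries u : exists n, forall v : V C, bil v u = \sum_(j < 6 + 6) n j * v 0 j.
Proof.
exists (fun j => bil (delta_mx 0 j) u) => v.
have bilr0 : bil 0 u = 0 by rewrite -(scale0r (0 : V C)) bilZl mul0r.
rewrite {1}[v]row_sum_delta.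
rewrite (big_morph (fun x => bil x u) (fun x y => bilDl x y u) bilr0).
by apply: eq_bigr => j _; rewrite bilZl mulrC.
Qed.

Variable m : {set 'I_6} -> {set 'I_6} -> C.
Hypothesis gE : forall psi K, g psi K = \sum_J m K J * psi J.

(** The coordinates of g psi as linear forms in psi, that is, the linear coordinates in which the
    section is diagonal; the ideal is studied through them. *)
Definition pulled_coord K : coord_ring C {set 'I_6} := linear_form (m K).

Lemma evalp_Y K psi : evalp (pulled_coord K) psi = g psi K.
Proof. by rewrite evalp_linear_form gE. Qed.

Lemma ideal_B w : exists F, I_s F /\ forall psi, OG_minus psi ->
  evalp F psi = bil (B phi psi) w.
Proof.
have [n bilE] := bil_entries w; have [l lE] := fin_all_exists (B_linear phi).
exists (\sum_j (n j)%:MP * linear_form (l j)); split.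
  apply: ideal_sum => j _; apply/idealM/ideal_gen; right.
  exists 0%N, 1, j; split; [exact: dhomog1|exact: linear_form_homog|].
  by move=> psi OGpsi; rewrite evalp_linear_form -lE sE // /evalp meval1 mul1r.
move=> psi OGpsi; rewrite bilE /evalp raddf_sum; apply: eq_bigr => j _ /=.
by rewrite mevalM mevalC -/(evalp _ _) evalp_linear_form lE.
Qed.

(** In even degree the form vanishes on [OG_minus]. In degrees 1 and 5 it is a multiple of a
    coordinate of the diagonal section at g psi, hence of a pairing of s psi with a fixed vector. *)
Lemma ideal_Y K : #|K| != 3 -> I_s (pulled_coord K).
Proof.
move=> K3; have [_ gOG gB] := g_inter.
have [oddK|evK] := boolP (odd #|K|); last first.
  by apply: ideal_OG => psi OGpsi; rewrite evalp_Y (OG_odd (gOG _ OGpsi)).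
have [kap [w kapE]] : exists kap w, forall psi, g psi K = kap * bil (B (diagonal a b) (g psi)) w.
  have sgn0 J i : sg C J i != 0 by rewrite /sg signr_eq0.
  have [i [] ->] := odd_not_cubic oddK K3.
    exists (a * sg C set0 i)^-1, (base C false i) => psi.
    rewrite bil_base [~~ _]/=; have [-> _] := B_diagonal a b (g psi) i.
    by rewrite [a * (_ * _)]mulrA mulKf // mulf_neq0.
  exists (b * sg C setT i)^-1, (base C true i) => psi.
  rewrite bil_base [~~ _]/=; have [_ ->] := B_diagonal a b (g psi) i.
  by rewrite [b * (_ * _)]mulrA mulKf // mulf_neq0.
have [u gBu] := gB w; have [F [IF FE]] := ideal_B u.
have -> : pulled_coord K = kap%:MP * F + (pulled_coord K - kap%:MP * F) by rewrite addrC subrK.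
apply: idealD; first exact: idealM.
apply: ideal_OG => psi OGpsi; rewrite /evalp mevalB mevalM mevalC -!/(evalp _ _).
by rewrite evalp_Y FE // kapE gBu subrr.
Qed.

Lemma ideal_quadric A K : I_s (\sum_(i | (i \in A) != (i \in K))
  ((sg C K i * sg C A i)%:MP * (pulled_coord (flip A i) * pulled_coord (flip K i)))).
Proof.
have [_ gOG _] := g_inter; apply: ideal_OG => psi OGpsi.
have /OG_minusP[_ _ puregpsi] := gOG _ OGpsi.
rewrite -[RHS](pure_coord A K puregpsi) /evalp raddf_sum; apply: eq_bigr => i _ /=.
by rewrite mevalM mevalC mevalM -!/(evalp _ _) !evalp_Y; ring.
Qed.

Section Chart.
Variable J0 : {set 'I_6}.
Hypothesis cardJ0 : #|J0| = 3.

(** J0 and the nine sets that differ from it by an exchange of one element: their coordinates are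
    homogeneous coordinates on the affine chart. *)
Definition near_J0 K : bool := (K == J0) ||
  [exists i, exists e, [&& i \notin J0, e \in J0 & K == flip (flip J0 i) e]].

Lemma near_J0_flip i e : i \notin J0 -> e \in J0 -> near_J0 (flip (flip J0 i) e).
Proof.
by move=> iJ eJ; apply/orP; right; apply/existsP; exists i; apply/existsP; exists e; rewrite iJ eJ eqxx.
Qed.

Definition chart_forms : #|{: {set 'I_6}}|.-tuple (coord_ring C {set 'I_6}) :=
  [tuple if near_J0 (enum_val i) then pulled_coord (enum_val i) else 0 | i < #|{: {set 'I_6}}|].

Definition chart (P : coord_ring C {set 'I_6}) : coord_ring C {set 'I_6} := P \mPo chart_forms.

Lemma chartX K : chart 'X_(enum_rank K) = if near_J0 K then pulled_coord K else 0.
Proof. by rewrite /chart comp_mpolyXU -tnth_nth tnth_mktuple enum_rankK. Qed.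

Lemma chartM P Q : chart (P * Q) = chart P * chart Q.
Proof. exact: rmorphM. Qed.

Lemma chartX0 : chart 'X_(enum_rank J0) = pulled_coord J0.
Proof. by rewrite chartX /near_J0 eqxx. Qed.

(* Modulo the ideal and up to powers of pulled_coord J0, F is a polynomial in the
   coordinates of the affine chart of G(3, 6). *)
Definition reducible F : Prop :=
  exists N P, I_s (pulled_coord J0 ^+ N * F - chart P).

Lemma reducible_ideal F : I_s F -> reducible F.
Proof.
by exists 0%N, 0; rewrite expr0 mul1r /chart comp_mpoly0 subr0.
Qed.

Lemma reducible_chart P : reducible (chart P).
Proof. by exists 0%N, P; rewrite expr0 mul1r subrr; apply: ideal0. Qed.

Lemma reducibleM F G : reducible F -> reducible G -> reducible (F * G).
Proof.
move=> [N [P IF]] [M [Q IG]]; exists (N + M)%N, (P * Q).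
by rewrite exprD mulrACA chartM; apply: ideal_congrM.
Qed.

Lemma reducibleD F G : reducible F -> reducible G -> reducible (F + G).
Proof.
move=> [N [P IF]] [M [Q IG]].
exists (N + M)%N, ('X_(enum_rank J0) ^+ M * P + 'X_(enum_rank J0) ^+ N * Q).
have -> : chart ('X_(enum_rank J0) ^+ M * P + 'X_(enum_rank J0) ^+ N * Q) =
    pulled_coord J0 ^+ M * chart P + pulled_coord J0 ^+ N * chart Q.
  by rewrite /chart rmorphD !rmorphM !rmorphXn /= -!/(chart _) chartX0.
have -> : pulled_coord J0 ^+ (N + M) * (F + G) - (pulled_coord J0 ^+ M * chart P + pulled_coord J0 ^+ N * chart Q) =
    pulled_coord J0 ^+ M * (pulled_coord J0 ^+ N * F - chart P) + pulled_coord J0 ^+ N * (pulled_coord J0 ^+ M * G - chart Q).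
  by rewrite exprD; ring.
by apply: idealD; apply: idealM.
Qed.

Lemma reducibleC c : reducible c%:MP.
Proof. by rewrite -(comp_mpolyC c chart_forms); apply: reducible_chart. Qed.

Lemma reducible_sum (I : Type) (r : seq I) (P : pred I) (F : I -> coord_ring C {set 'I_6}) :
  (forall i, P i -> reducible (F i)) -> reducible (\sum_(i <- r | P i) F i).
Proof.
move=> redF; apply: big_ind => //; last exact: reducibleD.
by apply/reducible_ideal/ideal0.
Qed.

Lemma reducible_quotient F G : I_s (pulled_coord J0 * F - G) -> reducible G -> reducible F.
Proof.
move=> IFG [N [P IG]]; exists N.+1, P.
have -> : pulled_coord J0 ^+ N.+1 * F - chart P =
    pulled_coord J0 ^+ N * (pulled_coord J0 * F - G) + (pulled_coord J0 ^+ N * G - chart P) by rewrite exprS; ring.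
by apply: idealD => //; apply: idealM.
Qed.

Lemma reducible_near i e : i != e -> reducible (pulled_coord (flip (flip J0 i) e)).
Proof.
move=> ie; have near K : near_J0 K -> reducible (pulled_coord K).
  by move=> nK; have := reducible_chart 'X_(enum_rank K); rewrite chartX nK.
have [iJ|iJ] := boolP (i \in J0); have [eJ|eJ] := boolP (e \in J0).
- apply/reducible_ideal/ideal_Y.
  rewrite {1}/flip mem_flip eJ [e == i]eq_sym (negPf ie) /flip iJ.
  move: cardJ0; rewrite (cardsD1 i) iJ (cardsD1 e (J0 :\ i)) !inE eJ [e == i]eq_sym ie !add1n.
  by case=> ->.
- by rewrite flipC; apply/near/near_J0_flip.
- exact/near/near_J0_flip.
- apply/reducible_ideal/ideal_Y.
  rewrite {1}/flip mem_flip (negPf eJ) [e == i]eq_sym (negPf ie) /flip (negPf iJ).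
  by rewrite cardsU1 !inE [e == i]eq_sym (negPf ie) (negPf eJ) cardsU1 iJ cardJ0.
Qed.

(** The recursion of [pure_unique], now modulo the ideal: the quadric for [flip J0 i] and [flip K i]
    contains the product of the coordinates at J0 and K. In each other term one factor is a chart
    coordinate or lies in the ideal by its degree, and the other factor is at a set closer to J0. *)
Lemma reducible_Y K : reducible (pulled_coord K).
Proof.
have [n] := ubnP #|[set i | (i \in K) != (i \in J0)]|.
elim: n K => // n IHn K; rewrite ltnS => le_n.
have [->|/eqP/setP-neq] := eqVneq K J0.
  by rewrite -chartX0; apply: reducible_chart.
have [i Ki] : exists i, (i \in K) != (i \in J0).
  apply/existsP; apply: contra_notT neq; rewrite negb_exists => /forallP e i.
  by apply/eqP; have := e i; rewrite negbK.
pose A := flip J0 i; pose K' := flip K i.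
have AK m' : ((m' \in A) != (m' \in K')) = ((m' \in K) != (m' \in J0)).
  by rewrite !mem_flip; case: (m' == i); case: (m' \in K); case: (m' \in J0).
pose c j := sg C K' j * sg C A j.
pose rest := \sum_(j | ((j \in A) != (j \in K')) && (j != i))
  ((c j)%:MP * (pulled_coord (flip A j) * pulled_coord (flip K' j))).
have ci : c i * c i = 1.
  by rewrite /c mulrACA !sg_sq mulr1.
apply: (@reducible_quotient _ (- (c i)%:MP * rest)).
  have := ideal_quadric A K'; rewrite (bigD1 i) /=; last by rewrite AK.
  rewrite -/rest -/(c i) /A /K' !flipK => /(idealM (c i)%:MP).
  rewrite mulrDr [_ * (_ * (pulled_coord J0 * _))]mulrA -mpolyCM ci mul1r.
  by rewrite mulNr opprK.
apply: reducibleM; first by rewrite -mpolyCN; apply: reducibleC.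
apply: reducible_sum => j /andP[]; rewrite AK => Kj ji.
apply: reducibleM; first exact: reducibleC.
apply: reducibleM; first by apply: reducible_near; rewrite eq_sym.
apply: IHn; apply: leq_trans le_n; apply: proper_card.
rewrite properE; apply/andP; split.
  apply/subsetP => l; rewrite !inE /K' !mem_flip.
  case: (eqVneq l j) => [->|_]; first by rewrite Kj.
  by case: (eqVneq l i) => [->|_]; rewrite ?Ki // !addbF.
apply/subsetPn; exists i; rewrite inE // /K' !mem_flip eqxx [i == j]eq_sym (negPf ji) addbF addbT.
by move: Ki; case: (i \in K); case: (i \in J0).
Qed.

Lemma reducible_all F : reducible F.
Proof.
have redX i : reducible 'X_i.
  have [[m' g'E] _ _] := g'_inter.
  (* As g' inverts g, the original variables are linear combinations of the pulled coordinates. *)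
  have -> : 'X_i = \sum_L (m' (enum_val i) L)%:MP * pulled_coord L :> coord_ring C {set 'I_6}.
    apply/eqP; rewrite -subr_eq0; apply/eqP/evalp_eq0 => psi.
    rewrite /evalp mevalB mevalXU (raddf_sum (meval _)) /= -{1}(gK psi) g'E.
    apply/eqP; rewrite subr_eq0; apply/eqP; apply: eq_bigr => L _.
    by rewrite mevalM mevalC -/(evalp _ _) evalp_Y.
  apply: reducible_sum => L _; apply: reducibleM; [exact: reducibleC | exact: reducible_Y].
elim/mpolyind: F => [|c mon F _ _ IHF]; first exact/reducible_ideal/ideal0.
apply: reducibleD => //; rewrite -mul_mpolyC; apply: reducibleM; first exact: reducibleC.
rewrite mpolyXE_id; apply: (big_ind reducible) => [||i _].
- by rewrite -mpolyC1; apply: reducibleC.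
- exact: reducibleM.
elim: (mon i) => [|k IHk]; first by rewrite expr0 -mpolyC1; apply: reducibleC.
by rewrite exprS; apply: reducibleM.
Qed.

(** This is the algebraic independence of the chart coordinates. For any psi with g psi nonzero at
    J0, on [OG_minus] or not, [chart_point] provides a point of the zero locus with the same chart
    coordinates, where [chart P] vanishes and takes the same value as at psi. *)
Lemma chart_ideal_eq0 P : pulled_coord J0 != 0 -> I_s (chart P) -> chart P = 0.
Proof.
move=> Y0 IP; suff : pulled_coord J0 * chart P = 0.
  by move/eqP; rewrite mulf_eq0 (negPf Y0) => /eqP.
apply: evalp_eq0 => psi; rewrite /evalp mevalM -!/(evalp _ _) evalp_Y.
have [->|gpsi0] := eqVneq (g psi J0) 0; first by rewrite mul0r.
have [chi [OGchi cub chi0 chiE]] := chart_point cardJ0 gpsi0.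
suff -> : evalp (chart P) psi = evalp (chart P) (g' chi).
  by rewrite (ideal_vanish IP) ?mulr0 //; apply: cubic_lift.
rewrite /evalp /chart !comp_mpoly_meval; apply: meval_eq => i.
rewrite !tnth_mktuple; case: ifP => [|_]; last by rewrite !meval0.
rewrite -!/(evalp _ _) !evalp_Y g'K => /orP[/eqP -> //|].
by move=> /existsP[j /existsP[e /and3P[jJ eJ /eqP ->]]]; rewrite chiE.
Qed.

(** If G F^k is in the ideal, the chart polynomials of G and F satisfy Q P^k = 0 after substitution,
    by [chart_ideal_eq0]. Polynomials form a domain: the factor from G cannot vanish because G is
    nonzero at psi, so that of F does, and a power of the coordinate at J0 carries F into the
    ideal. *)
Lemma reduced_chart psi : zero_locus s psi -> g psi J0 != 0 -> reduced_at I_s psi.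
Proof.
move=> Zpsi gpsi0 F k [G G0 IG].
have evY : evalp (pulled_coord J0) psi != 0 by rewrite evalp_Y.
have Y0 : pulled_coord J0 != 0 by apply: contraNneq evY => ->; rewrite /evalp meval0.
have [M [Q IQ]] := reducible_all G; have [N [P IP]] := reducible_all F.
have IQP : I_s (chart (Q * P ^+ k)).
  have -> : chart (Q * P ^+ k) = (pulled_coord J0 ^+ M * (pulled_coord J0 ^+ N) ^+ k) * (G * F ^+ k) +
      (-1) * ((pulled_coord J0 ^+ M * G) * (pulled_coord J0 ^+ N * F) ^+ k - chart Q * chart P ^+ k).
    by rewrite /chart rmorphM rmorphXn /= exprMn; ring.
  by apply: idealD; apply: idealM => //; apply: ideal_congrM => //; apply: ideal_congrX.
have /eqP := chart_ideal_eq0 Y0 IQP.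
rewrite /chart rmorphM rmorphXn /= -!/(chart _) mulf_eq0 expf_eq0 => /orP[/eqP Q0|/andP[_ /eqP P0]].
  have := ideal_vanish IQ Zpsi; rewrite Q0 subr0 /evalp mevalM rmorphXn -!/(evalp _ _) => /eqP.
  by rewrite mulf_eq0 expf_eq0 (negPf evY) andbF (negPf G0).
exists (pulled_coord J0 ^+ N); last by move: IP; rewrite P0 subr0.
by rewrite /evalp rmorphXn expf_neq0.
Qed.

End Chart.

Lemma zero_locus_reduced psi : zero_locus s psi -> reduced_at I_s psi.
Proof.
move=> Zpsi; have /zero_locusE[OGpsi cub] := Zpsi.
have [_ gOG _] := g_inter; have /OG_minusP[gpsi0 _ _] := gOG _ OGpsi.
have [J0 nz] := spinor_neq0 gpsi0.
apply: (@reduced_chart J0) => //.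
by apply/eqP; apply: contraNT nz => /cub ->.
Qed.

End ZeroLocus.

Lemma general_spinor_zero_locus (C : numClosedFieldType) :
  for_general_section (fun s : spinor C -> V C =>
    (forall psi, zero_locus s psi -> reduced_at (zero_scheme_ideal s) psi) /\
    isomorphic_varieties (zero_locus s) (@grassmannian C 3 6)).
Proof.
exists #|even_sets|, (@spinor_section C), (genericity (generic_spinor C)).
split=> [||s c _ s_coord]; [exact: spinor_section_basis|exact: genericity_neq0|].
rewrite meval_genericity => gen_c; set phi := spinor_of c in gen_c.
have sE psi : OG_minus psi -> s psi = B phi psi.
  by move=> /s_coord ->; apply: spinor_section_sum.
have odd_phi : vanishes odd_bits phi.
  move=> q; rewrite mem_filter => /andP[odd_q q6]; apply: spinor_of_odd.
  have -> : set_of_bits q = [set j : 'I_6 | nth false q j] by [].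
  rewrite card_bits //.
  by rewrite leq_eqVlt; apply/orP; left; move: q q6 {odd_q}; apply/allP; vm_compute.
have [a [b [a0 b0 [g [g' [gK g'K gi gi']]]]]] := diagonalize odd_phi gen_c.
split; last exact: zero_locus_isomorphic a0 b0 sE gK g'K gi gi'.
by have [[m gE] _ _] := gi; apply: zero_locus_reduced a0 b0 sE gK g'K gi gi' m gE.
Qed.

Theorem proposition28 (R : realType) :
  for_general_section (fun s : spinor R[i] -> V R[i] =>
    (forall psi, zero_locus s psi -> reduced_at (zero_scheme_ideal s) psi) /\
    isomorphic_varieties (zero_locus s) (@grassmannian R[i] 3 6)).
Proof. exact: general_spinor_zero_locus. Qed.
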